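(* Let $A$ be a cohomologically bounded tractable commutative DG ring and let $\bar{A} := \mathrm{H}^0(A)$. If $\bar{A}$ is a perfect DG $A$-module, then the canonical homomorphism $A \to \bar{A}$ is a quasi-isomorphism.
   Context: A commutative DG ring is a graded associative unital ring $A=\bigoplus_{i\le 0}A^i$ with a differential $\mathrm{d}$ of degree $1$ satisfying the graded Leibniz rule, such that $b\cdot a=(-1)^{ij}a\cdot b$ for $a\in A^i$, $b\in A^j$, and $a\cdot a=0$ for $a\in A^i$ with $i$ odd. There is a canonical DG ring homomorphism $A\to\bar A$, which makes $\bar A$ a DG $A$-module. $A$ is cohomologically bounded if $\mathrm{H}^i(A)=0$ for all but finitely many $i$. $\mathsf{D}(A)$ is the derived category of DG $A$-modules (quasi-isomorphisms inverted). $A$ is cohomologically pseudo-noetherian if $\bar A$ is noetherian and every $\mathrm{H}^i(A)$ is a finitely generated $\bar A$-module. $A$ is tractable if it is cohomologically pseudo-noetherian and there exists a DG ring homomorphism $\mathbb{K}\to A$ from some finite dimensional regular noetherian commutative ring $\mathbb{K}$ such that the induced ring homomorphism $\mathbb{K}\to\bar A$ is essentially of finite type (a localization of a finitely generated $\mathbb{K}$-ring). A DG $A$-module is perfect if it belongs to the smallest full subcategory of $\mathsf{D}(A)$ that contains $A$ and is closed under shifts, cones, direct summands and isomorphisms. *)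

(* Defs.v *)
From HB Require Import structures.
From mathcomp Require Import all_boot all_order all_algebra.
From mathcomp Require Import boolp.
Set Implicit Arguments.
Unset Strict Implicit.
Unset Printing Implicit Defensive.
Import Order.TTheory GRing.Theory Num.Theory.
Local Open Scope ring_scope.
Local Open Scope quotient_scope.

(* Graded objects are families indexed by int.  An operation whose result     *)
(* lives in degree i + j takes an arbitrary degree k and a proof of i + j = k *)
(* so that no transport is needed to state associativity and similar laws;    *)
(* such proofs are unique because int has decidable equality.                 *)

Record complex := Complex {
  cgr :> int -> zmodType;
  cd : forall i j : int, i + 1 = j -> cgr i -> cgr j;
  cdB : forall (i j : int) (ij : i + 1 = j),
    {morph cd ij : x y / x - y};
  cdd : forall (i j k : int) (ij : i + 1 = j) (jk : j + 1 = k) (x : cgr i),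
    cd jk (cd ij x) = 0 }.

HB.instance Definition _ (C : complex) (i j : int) (ij : i + 1 = j) :=
  GRing.isZmodMorphism.Build (C i) (C j) (@cd C i j ij) (@cdB C i j ij).

Section Cohomology.
Variables (C : complex) (i : int).

Definition cocycles : {pred C i} := [pred x | cd (erefl (i + 1)) x == 0].

Lemma cocycles_closed : zmod_closed cocycles.
Proof.
split=> [|x y]; first by rewrite inE raddf0.
by rewrite !inE => /eqP xZ /eqP yZ; rewrite cdB xZ yZ subrr.
Qed.

HB.instance Definition _ := GRing.isZmodClosed.Build (C i) cocycles
  cocycles_closed.

Definition cocycle : Type := {x : C i | x \in cocycles}.
HB.instance Definition _ := SubChoice.on cocycle.
HB.instance Definition _ := [SubChoice_isSubZmodule of cocycle by <:].

Definition coboundaries : {pred cocycle} :=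
  [pred x | `[< exists y : C (i - 1), val x = cd (subrK 1 i) y >]].

Lemma coboundaries_closed : zmod_closed coboundaries.
Proof.
split=> [|x y]; first by rewrite inE; apply/asboolP; exists 0; rewrite !raddf0.
rewrite !inE => /asboolP[a xa] /asboolP[b yb]; apply/asboolP.
by exists (a - b); rewrite !raddfB /= xa yb.
Qed.

HB.instance Definition _ := GRing.isZmodClosed.Build cocycle coboundaries
  coboundaries_closed.

Definition coh : Type := (Quotient.quot coboundaries).
HB.instance Definition _ := GRing.Zmodule.on coh.

Definition cclass (x : cocycle) : coh := \pi_(Quotient.quot coboundaries) x.
Definition crepr (u : coh) : cocycle := repr (u : (Quotient.quot coboundaries)).

Lemma creprK : cancel crepr cclass.
Proof. by move=> u; rewrite /cclass /crepr reprK. Qed.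

Lemma cclassB : {morph cclass : x y / x - y}.
Proof. by move=> x y; rewrite /cclass raddfB. Qed.

HB.instance Definition _ :=
  GRing.isZmodMorphism.Build cocycle coh cclass cclassB.

Lemma cohE (u : coh) : exists x, u = cclass x.
Proof. by exists (crepr u); rewrite creprK. Qed.

Lemma cclass_eq (x y : cocycle) :
  cclass x = cclass y <-> exists z, val x - val y = cd (subrK 1 i) z.
Proof.
have -> : (val x - val y) = val (x - y) by [].
rewrite /cclass; split=> [/eqP|xy]; last apply/eqP.
  by rewrite -Quotient.idealrBE inE => /asboolP.
by rewrite -Quotient.idealrBE inE; apply/asboolP.
Qed.

Lemma cocycleP (x : cocycle) (j : int) (ij : i + 1 = j) : cd ij (val x) = 0.
Proof. by case: _ / ij; have := valP x; rewrite inE => /eqP. Qed.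

End Cohomology.
Arguments cocycles : clear implicits.
Arguments coboundaries : clear implicits.

Record chmap (C D : complex) := ChMap {
  cm :> forall i : int, C i -> D i;
  cmB : forall i : int, {morph @cm i : x y / x - y};
  cm_d : forall (i j : int) (ij : i + 1 = j) (x : C i),
    cm (cd ij x) = cd ij (cm x) }.
Arguments cm {C D} c i x.

HB.instance Definition _ (C D : complex) (f : chmap C D) (i : int) :=
  GRing.isZmodMorphism.Build (C i) (D i) (f i) (@cmB C D f i).

Section CohomologyMap.
Variables (C D : complex) (f : chmap C D) (i : int).

Lemma cocycle_map_subproof (x : cocycle C i) : f i (val x) \in cocycles D i.
Proof. by rewrite inE -cm_d cocycleP raddf0. Qed.

Definition cocycle_map (x : cocycle C i) : cocycle D i :=
  Sub (f i (val x)) (cocycle_map_subproof x).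

Definition coh_map (u : coh C i) : coh D i := cclass (cocycle_map (crepr u)).

Lemma coh_map_class (x : cocycle C i) :
  coh_map (cclass x) = cclass (cocycle_map x).
Proof.
apply/cclass_eq; have [] := cclass_eq (crepr (cclass x)) x.
rewrite creprK => /(_ erefl)[z e] _; exists (f _ z).
by rewrite /= -cmB e cm_d.
Qed.

End CohomologyMap.

Definition quasi_iso (C D : complex) (f : chmap C D) : Prop :=
  forall i : int, bijective (@coh_map C D f i).

Lemma quasi_isoP (C D : complex) (f : chmap C D) :
  quasi_iso f <-> forall (h i j : int) (hi : h + 1 = i) (ij : i + 1 = j),
    (forall x : C i, cd ij x = 0 ->
       (exists y, f i x = cd hi y) -> exists y, x = cd hi y) /\
    (forall y : D i, cd ij y = 0 ->
       exists2 x : C i, cd ij x = 0 & exists z, f i x - y = cd hi z).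
Proof.
split=> [qf h i j hi ij|qf i]; last first.
  have [inj sur] := qf _ _ _ (subrK 1 i) (erefl (i + 1)).
  have g_ex (u : coh D i) : exists v, coh_map f v = u.
    have [y ->] := cohE u.
    have [x xZ [z e]] := sur (val y) (cocycleP y _).
    have xC : x \in cocycles C i by rewrite inE xZ.
    exists (cclass (Sub x xC)); rewrite coh_map_class.
    by apply/cclass_eq; exists z.
  exists (fun u => projT1 (cid (g_ex u))) => u; last first.
    by case: cid.
  case: cid => v /=.
  have [x ->] := cohE u; have [x' ->] := cohE v.
  rewrite !coh_map_class => /cclass_eq [z] /=; rewrite -cmB => e.
  have [||y ey] := inj (val x' - val x).
  - by rewrite cdB !cocycleP subrr.
  - by exists z.
  by apply/cclass_eq; exists y.
have hE : h = i - 1 by rewrite -hi addrK.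
move: hi; rewrite hE => hi; rewrite (eq_irrelevance hi (subrK 1 i)).
case: _ / ij => {h hE hi j}.
have [g fK gK] := qf i; split=> [x xZ [y e]|y yZ].
  have xC : x \in cocycles C i by rewrite inE xZ.
  have : cclass (Sub x xC : cocycle C i) = cclass 0.
    apply: (can_inj fK); rewrite !coh_map_class; apply/cclass_eq.
    by exists y; rewrite /= raddf0 subr0.
  by case/cclass_eq => z; rewrite /= subr0 => ->; exists z.
have yC : y \in cocycles D i by rewrite inE yZ.
have := gK (cclass (Sub y yC)).
have [x ->] := cohE (g (cclass (Sub y yC))).
rewrite coh_map_class => /cclass_eq [z] /= e.
by exists (val x); [exact: cocycleP | exists z].
Qed.

Definition chmap_id (C : complex) : chmap C C.
Proof. by exists (fun i => @id (C i)). Defined.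

Definition chmap_comp (C D E : complex) (g : chmap D E) (f : chmap C D) :
  chmap C E.
Proof.
exists (fun i => g i \o f i) => [i x y|i j ij x] /=; first by rewrite !cmB.
by rewrite !cm_d.
Defined.

Record cdgring := CDGRing {
  dgr_cx :> complex;
  dgr1 : dgr_cx 0;
  dgrM : forall i j k : int, i + j = k -> dgr_cx i -> dgr_cx j -> dgr_cx k;
  dgrMBl : forall (i j k : int) (e : i + j = k) (b : dgr_cx j),
    {morph (dgrM e)^~ b : x y / x - y};
  dgrMBr : forall (i j k : int) (e : i + j = k) (a : dgr_cx i),
    {morph dgrM e a : x y / x - y};
  dgrMA : forall (i j k ij jk l : int) (e1 : i + j = ij) (e2 : ij + k = l)
      (e3 : j + k = jk) (e4 : i + jk = l)
      (a : dgr_cx i) (b : dgr_cx j) (c : dgr_cx k),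
    dgrM e2 (dgrM e1 a b) c = dgrM e4 a (dgrM e3 b c);
  dgrM1l : forall (i : int) (e : 0 + i = i) (a : dgr_cx i), dgrM e dgr1 a = a;
  dgrM1r : forall (i : int) (e : i + 0 = i) (a : dgr_cx i), dgrM e a dgr1 = a;
  dgrMd : forall (i j k i' j' l : int) (e : i + j = k)
      (ei : i + 1 = i') (ej : j + 1 = j') (ek : k + 1 = l)
      (e1 : i' + j = l) (e2 : i + j' = l) (a : dgr_cx i) (b : dgr_cx j),
    cd ek (dgrM e a b) =
      dgrM e1 (cd ei a) b + dgrM e2 a (cd ej b) *~ (-1) ^ i;
  dgr_nonpos : forall (i : int) (a : dgr_cx i), 0 < i -> a = 0;
  dgrMC : forall (i j k : int) (e : i + j = k) (e' : j + i = k)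
      (a : dgr_cx i) (b : dgr_cx j),
    dgrM e' b a = dgrM e a b *~ (-1) ^ (i * j);
  dgrMsq : forall (i k : int) (e : i + i = k) (a : dgr_cx i),
    odd `|i|%N -> dgrM e a a = 0 }.

Record dgrhom (A B : cdgring) := DGRHom {
  rh_cm :> chmap A B;
  rh1 : rh_cm 0 (dgr1 A) = dgr1 B;
  rhM : forall (i j k : int) (e : i + j = k) (a : A i) (b : A j),
    rh_cm k (dgrM e a b) = dgrM e (rh_cm i a) (rh_cm j b) }.

Section DGRingCohomology.
Variable A : cdgring.
Implicit Types i j k : int.

Lemma dgrM0l i j k (e : i + j = k) (b : A j) : dgrM e 0 b = 0.
Proof. by rewrite -(subrr 0) dgrMBl subrr. Qed.

Lemma dgrM0r i j k (e : i + j = k) (a : A i) : dgrM e a 0 = 0.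
Proof. by rewrite -(subrr 0) dgrMBr subrr. Qed.

Lemma cocycle_mul_subproof i j k (e : i + j = k) (x : cocycle A i)
  (y : cocycle A j) : dgrM e (val x) (val y) \in cocycles A k.
Proof.
rewrite inE; apply/eqP.
have e1 : (i + 1) + j = k + 1 by rewrite -e addrAC.
have e2 : i + (j + 1) = k + 1 by rewrite -e addrA.
rewrite (dgrMd e (erefl _) (erefl _) (erefl _) e1 e2) !cocycleP.
by rewrite dgrM0l dgrM0r mul0rz addr0.
Qed.

Definition cocycle_mul i j k (e : i + j = k) (x : cocycle A i)
  (y : cocycle A j) : cocycle A k := Sub (dgrM e (val x) (val y)) (cocycle_mul_subproof e x y).

Definition coh_mul i j k (e : i + j = k) (u : coh A i) (v : coh A j) :
  coh A k := cclass (cocycle_mul e (crepr u) (crepr v)).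

Lemma coh_mul_class i j k (e : i + j = k) (x : cocycle A i) (y : cocycle A j) :
  coh_mul e (cclass x) (cclass y) = cclass (cocycle_mul e x y).
Proof.
rewrite /coh_mul; set x' := crepr _; set y' := crepr _.
have : cclass x' = cclass x by rewrite creprK.
move/cclass_eq => [a ea].
have : cclass y' = cclass y by rewrite creprK.
move/cclass_eq => [b eb].
apply/cclass_eq => /=.
have -> : dgrM e (val x') (val y') - dgrM e (val x) (val y) =
    dgrM e (val x' - val x) (val y') + dgrM e (val x) (val y' - val y).
  by rewrite dgrMBl dgrMBr addrA subrK.
have e1 : (i - 1) + j = k - 1 by rewrite -e addrAC.
have e2 : i + (j - 1) = k - 1 by rewrite -e addrA.
have e3 : i + 1 + (j - 1) = k by rewrite -e addrACA subrr addr0.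
have e4 : (i - 1) + (j + 1) = k by rewrite -e addrACA addNr addr0.
exists (dgrM e1 a (val y') + dgrM e2 (val x) b *~ (-1) ^ i).
rewrite raddfD raddfMz /=.
rewrite (dgrMd e1 (subrK 1 i) (erefl _) _ e e4) cocycleP dgrM0r mul0rz addr0.
rewrite (dgrMd e2 (erefl _) (subrK 1 j) _ e3 e) cocycleP dgrM0l add0r.
by rewrite ea eb -mulrzA -exprMz_comm // mulrNN mulr1 exp1rz.
Qed.

Lemma cocycle1_subproof : dgr1 A \in cocycles A 0.
Proof.
by rewrite inE; apply/eqP; apply: dgr_nonpos; rewrite add0r.
Qed.

Definition coh1 : coh A 0 := cclass (Sub (dgr1 A) cocycle1_subproof).

Lemma coh_mulA i j k ij jk l (e1 : i + j = ij) (e2 : ij + k = l)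
    (e3 : j + k = jk) (e4 : i + jk = l)
    (a : coh A i) (b : coh A j) (c : coh A k) :
  coh_mul e2 (coh_mul e1 a b) c = coh_mul e4 a (coh_mul e3 b c).
Proof.
have [x ->] := cohE a; have [y ->] := cohE b; have [z ->] := cohE c.
rewrite !coh_mul_class; congr cclass; apply: val_inj => /=.
exact: dgrMA.
Qed.

Lemma coh_mul1l i (e : 0 + i = i) : left_id coh1 (coh_mul e).
Proof.
move=> a; have [x ->] := cohE a.
rewrite coh_mul_class; congr cclass; apply: val_inj => /=.
exact: dgrM1l.
Qed.

Lemma coh_mulDl i j k (e : i + j = k) (a b : coh A i) (c : coh A j) :
  coh_mul e (a + b) c = coh_mul e a c + coh_mul e b c.
Proof.
have [x ->] := cohE a; have [y ->] := cohE b; have [z ->] := cohE c.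
rewrite -raddfD !coh_mul_class -raddfD; congr cclass; apply: val_inj => /=.
by rewrite -{1}(opprK (val y)) dgrMBl -(sub0r (val y)) dgrMBl dgrM0l sub0r opprK.
Qed.

Lemma coh_mulDr i j k (e : i + j = k) (c : coh A i) (a b : coh A j) :
  coh_mul e c (a + b) = coh_mul e c a + coh_mul e c b.
Proof.
have [x ->] := cohE a; have [y ->] := cohE b; have [z ->] := cohE c.
rewrite -raddfD !coh_mul_class -raddfD; congr cclass; apply: val_inj => /=.
by rewrite -{1}(opprK (val y)) dgrMBr -(sub0r (val y)) dgrMBr dgrM0r sub0r opprK.
Qed.

Lemma coh_mulC (e : 0 + 0 = 0 :> int) : commutative (coh_mul e).
Proof.
move=> a b; have [x ->] := cohE a; have [y ->] := cohE b.
rewrite !coh_mul_class; congr cclass; apply: val_inj => /=.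
by rewrite (dgrMC e) mulr0 expr0z mulr1z.
Qed.

End DGRingCohomology.

Definition Hbar (A : cdgring) : Type := coh A 0.
HB.instance Definition _ (A : cdgring) := GRing.Zmodule.on (Hbar A).
HB.instance Definition _ (A : cdgring) :=
  GRing.Zmodule_isComPzRing.Build (Hbar A)
    (fun a b c => esym (coh_mulA (addr0 0) (addr0 0) (addr0 0) (addr0 0) a b c))
    (coh_mulC (addr0 0)) (coh_mul1l (addr0 0)) (coh_mulDl (addr0 0)).

Section CohLmodule.
Variables (A : cdgring) (i : int).
Let scale (a : Hbar A) (u : coh A i) : coh A i := coh_mul (add0r i) a u.
Let scaleA a b u : scale a (scale b u) = scale (a * b) u.
Proof. by rewrite /scale (coh_mulA (addr0 0) (add0r i) (add0r i) (add0r i)). Qed.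
Let scale1 : left_id 1 scale.
Proof. exact: coh_mul1l. Qed.
Let scaleDr : right_distributive scale +%R.
Proof. by move=> *; apply: coh_mulDr. Qed.
Let scaleDl u : {morph scale^~ u : a b / a + b}.
Proof. by move=> *; apply: coh_mulDl. Qed.
HB.instance Definition _ := GRing.Zmodule_isLmodule.Build (Hbar A) (coh A i)
  scaleA scale1 scaleDr scaleDl.
End CohLmodule.

(* The degree i component of V placed in degree 0: all of V if i = 0, and the *)
(* zero subgroup of V otherwise.                                              *)
Definition conc_pred (V : zmodType) (i : int) : {pred V} :=
  [pred x | (i == 0) || (x == 0)].
Arguments conc_pred : clear implicits.
Lemma conc_closed (V : zmodType) (i : int) : zmod_closed (conc_pred V i).
Proof.
rewrite /conc_pred; split=> [|x y]; rewrite !inE ?eqxx ?orbT //.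
by case: (i == 0) => //= /eqP-> /eqP->; rewrite subrr.
Qed.
HB.instance Definition _ (V : zmodType) (i : int) :=
  GRing.isZmodClosed.Build V (conc_pred V i) (conc_closed V i).
Definition conc (V : zmodType) (i : int) : Type :=
  {x : V | x \in conc_pred V i}.
HB.instance Definition _ V i := SubChoice.on (conc V i).
HB.instance Definition _ V i := [SubChoice_isSubZmodule of conc V i by <:].

Definition conc_cx (V : zmodType) : complex.
Proof.
apply: (@Complex (fun i => conc V i : zmodType) (fun _ _ _ _ => 0)) => //.
by move=> i j ij x y; rewrite subrr.
Defined.

Definition conc_in (V : zmodType) (x : V) : conc V 0 := Sub x isT.

Section RingAsDGRing.
Variable R : comPzRingType.

Lemma conc_mul_subproof (i j k : int) (e : i + j = k)
  (x : conc R i) (y : conc R j) : val x * val y \in conc_pred R k.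
Proof.
have := valP y; have := valP x; rewrite !inE -e.
move: (val x) (val y) => a b.
case/orP=> [/eqP->|/eqP->]; last by rewrite mul0r eqxx orbT.
by case/orP=> [/eqP->|/eqP->]; rewrite ?mulr0 ?eqxx ?orbT.
Qed.

Definition conc_mul (i j k : int) (e : i + j = k) (x : conc R i) (y : conc R j) :
  conc R k := Sub (val x * val y) (conc_mul_subproof e x y).

Lemma conc0 (i : int) (x : conc R i) : i != 0 -> x = 0.
Proof.
move=> i0; apply: val_inj.
by have := valP x; rewrite inE (negPf i0) => /eqP.
Qed.

Definition dgring_of_ring : cdgring.
Proof.
apply: (@CDGRing (conc_cx R) (conc_in (1 : R)) conc_mul).
- by move=> i j k e b x y; apply: val_inj; rewrite /= mulrBl.
- by move=> i j k e b x y; apply: val_inj; rewrite /= mulrBr.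
- by move=> *; apply: val_inj; rewrite /= mulrA.
- by move=> *; apply: val_inj; rewrite /= mul1r.
- by move=> *; apply: val_inj; rewrite /= mulr1.
- move=> i j k i' j' l e _ _ ek e1 e2 a b /=.
  have -> : conc_mul e1 0 b = 0 by apply: val_inj; rewrite /= mul0r.
  have -> : conc_mul e2 a 0 = 0 by apply: val_inj; rewrite /= mulr0.
  by rewrite mul0rz addr0.
- by move=> i a i0; apply: conc0; rewrite gt_eqF.
- move=> i j k e e' a b.
  have [i0|i0] := eqVneq i 0; last first.
    rewrite (conc0 a i0).
    have -> : conc_mul e' b 0 = 0 by apply: val_inj; rewrite /= mulr0.
    have -> : conc_mul e 0 b = 0 by apply: val_inj; rewrite /= mul0r.
    by rewrite mul0rz.
  have -> : i * j = 0 by rewrite i0 mul0r.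
  rewrite expr0z mulr1z; apply: val_inj => /=; exact: mulrC.
- move=> i k e a oi.
  have i0 : i != 0 by case: eqP oi => // ->.
  by rewrite (conc0 a i0); apply: val_inj; rewrite /= mulr0.
Defined.

End RingAsDGRing.

Section Canonical.
Variable A : cdgring.

Lemma deg0_cocycle_subproof (x : A 0) : x \in cocycles A 0.
Proof. by rewrite inE; apply/eqP; apply: dgr_nonpos; rewrite add0r. Qed.

Definition deg0_class (x : A 0) : Hbar A :=
  cclass (Sub x (deg0_cocycle_subproof x)).

Definition canon_fun (i : int) : A i -> conc (Hbar A) i :=
  match i return A i -> conc (Hbar A) i with
  | Posz 0 => fun x => conc_in (deg0_class x)
  | _ => fun _ => 0
  end.

Lemma canon_fun0 (i : int) (x : A i) : i != 0 -> canon_fun x = 0.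
Proof. by case: i x => [[|n]|n]. Qed.

Lemma deg0_classB : {morph deg0_class : x y / x - y}.
Proof. by move=> x y; rewrite /deg0_class -cclassB; congr cclass; apply: val_inj. Qed.

Lemma canon_funB (i : int) : {morph @canon_fun i : x y / x - y}.
Proof.
case: i => [[|n]|n] x y /=; rewrite ?subrr //.
by rewrite deg0_classB; apply: val_inj.
Qed.

Lemma canon_funz (i : int) : canon_fun (0 : A i) = 0.
Proof. by rewrite -(subrr 0) canon_funB subrr. Qed.

Lemma canon_fun_d (i j : int) (ij : i + 1 = j) (x : A i) :
  canon_fun (cd ij x) = 0.
Proof.
have [j0|] := eqVneq j 0; last exact: canon_fun0.
have ei : i = 0 - 1 by rewrite -j0 -ij addrK.
move: ij x; rewrite j0 ei => ij x {i j ei j0}; apply: val_inj => /=.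
rewrite -[RHS](raddf0 (@cclass A 0)).
apply/cclass_eq; exists x; rewrite /= subr0.
by rewrite (eq_irrelevance ij (subrK 1 0)).
Qed.

Lemma canon_funM (i j k : int) (e : i + j = k) (a : A i) (b : A j) :
  canon_fun (dgrM e a b) = conc_mul e (canon_fun a) (canon_fun b).
Proof.
have [->|a0] := eqVneq a 0.
  rewrite dgrM0l !canon_funz; apply: val_inj => /=.
  by rewrite mul0r.
have [->|b0] := eqVneq b 0.
  rewrite dgrM0r !canon_funz; apply: val_inj => /=.
  by rewrite mulr0.
have [i0|i0] := ltP 0 i; first by rewrite (dgr_nonpos a i0) eqxx in a0.
have [j0|j0] := ltP 0 j; first by rewrite (dgr_nonpos b j0) eqxx in b0.
have [k0|k0] := eqVneq k 0; last first.
  rewrite (canon_fun0 _ k0); apply: val_inj => /=; apply/esym/eqP.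
  have [i1|i1] := eqVneq i 0; last by rewrite (canon_fun0 _ i1) mul0r.
  have j1 : j != 0 by rewrite -(add0r j) -[X in X + j]i1 e.
  by rewrite (canon_fun0 _ j1) mulr0.
have /andP[/eqP i1 /eqP j1] : (i == 0) && (j == 0).
  by rewrite -naddr_eq0 // e k0.
move: e a b {a0 b0 i0 j0}; rewrite i1 j1 k0 => e a b; apply: val_inj => /=.
rewrite [RHS]coh_mul_class; congr cclass; apply: val_inj => /=.
by rewrite (eq_irrelevance e (addr0 0)).
Qed.

Lemma canon_fun1 : canon_fun (dgr1 A) = conc_in (1 : Hbar A).
Proof. by apply: val_inj; congr cclass; apply: val_inj. Qed.

Definition canon_cm : chmap A (dgring_of_ring (Hbar A)) :=
  @ChMap A (dgring_of_ring (Hbar A)) canon_fun canon_funB canon_fun_d.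

Definition canon : dgrhom A (dgring_of_ring (Hbar A)) :=
  @DGRHom A (dgring_of_ring (Hbar A)) canon_cm canon_fun1 canon_funM.

End Canonical.

Record dgmod (A : cdgring) := DGMod {
  dgm_cx :> complex;
  act : forall i j k : int, i + j = k -> A i -> dgm_cx j -> dgm_cx k;
  actBl : forall (i j k : int) (e : i + j = k) (m : dgm_cx j),
    {morph (act e)^~ m : a b / a - b};
  actBr : forall (i j k : int) (e : i + j = k) (a : A i),
    {morph act e a : m n / m - n};
  actA : forall (i j k ij jk l : int) (e1 : i + j = ij) (e2 : ij + k = l)
      (e3 : j + k = jk) (e4 : i + jk = l) (a : A i) (b : A j) (m : dgm_cx k),
    act e2 (dgrM e1 a b) m = act e4 a (act e3 b m);
  act1 : forall (i : int) (e : 0 + i = i) (m : dgm_cx i), act e (dgr1 A) m = m;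
  act_d : forall (i j k i' j' l : int) (e : i + j = k)
      (ei : i + 1 = i') (ej : j + 1 = j') (ek : k + 1 = l)
      (e1 : i' + j = l) (e2 : i + j' = l) (a : A i) (m : dgm_cx j),
    cd ek (act e a m) = act e1 (cd ei a) m + act e2 a (cd ej m) *~ (-1) ^ i }.

Record dghom (A : cdgring) (M N : dgmod A) := DGHom {
  dh_cm :> chmap M N;
  dh_act : forall (i j k : int) (e : i + j = k) (a : A i) (m : M j),
    dh_cm k (act e a m) = act e a (dh_cm j m) }.

Section DGModules.
Variable A : cdgring.
Implicit Types (M N : dgmod A) (i j k n : int).

Definition dghom_id M : dghom M M.
Proof. by exists (chmap_id M). Defined.

Definition dghom_comp M N P (g : dghom N P) (f : dghom M N) : dghom M P.
Proof. by exists (chmap_comp g f) => i j k e a m /=; rewrite !dh_act. Defined.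

Definition regular_mod : dgmod A :=
  @DGMod A A (@dgrM A) (@dgrMBl A) (@dgrMBr A) (@dgrMA A) (@dgrM1l A) (@dgrMd A).

Lemma act0 M i j k (e : i + j = k) (a : A i) : act e a (0 : M j) = 0.
Proof. by rewrite -(subrr 0) actBr subrr. Qed.

Lemma actD M i j k (e : i + j = k) (a : A i) (x y : M j) :
  act e a (x + y) = act e a x + act e a y.
Proof. by rewrite -{1}(opprK y) -(sub0r y) !actBr act0 sub0r opprK. Qed.

Lemma actN M i j k (e : i + j = k) (a : A i) (x : M j) :
  act e a (- x) = - act e a x.
Proof. by rewrite -(sub0r x) actBr act0 sub0r. Qed.

Lemma actMn M i j k (e : i + j = k) (a : A i) (x : M j) m :
  act e a (x *+ m) = act e a x *+ m.
Proof. by elim: m => [|m IHm]; rewrite ?mulr0n ?act0 // !mulrS actD IHm. Qed.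

Lemma actMz M i j k (e : i + j = k) (a : A i) (x : M j) m :
  act e a (x *~ m) = act e a x *~ m.
Proof. by case: m => m; rewrite ?NegzE ?mulrNz ?actN -!pmulrn actMn. Qed.

Lemma sgnM i j : ((-1) ^ (i + j) : int) = (-1) ^ i * (-1) ^ j.
Proof. exact: exprzDr. Qed.

Lemma sgn_sq i : ((-1) ^ i * (-1) ^ i : int) = 1.
Proof. by rewrite -exprMz_comm // mulrNN mulr1 exp1rz. Qed.

(* Shift: (M[n])^i = M^(i+n), with differential (-1)^n d and action           *)
(* a . m = (-1)^(n i) a m for a in A^i.                                       *)
Lemma shift_d_eq n i j : i + 1 = j -> (i + n) + 1 = j + n.
Proof. by move <-; rewrite addrAC. Qed.

Lemma shift_act_eq n i j k : i + j = k -> i + (j + n) = k + n.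
Proof. by move <-; rewrite addrA. Qed.

Definition shift_cx n (C : complex) : complex.
Proof.
exists (fun i => C (i + n))
  (fun i j ij x => cd (shift_d_eq n ij) x *~ (-1) ^ n).
- by move=> i j ij x y; rewrite cdB mulrzBl.
- by move=> i j k ij jk x; rewrite raddfMz /= cdd !mul0rz.
Defined.

Definition shift n M : dgmod A.
Proof.
exists (shift_cx n M)
  (fun i j k e a (m : M (j + n)) => act (shift_act_eq n e) a m *~ (-1) ^ (n * i)).
- by move=> i j k e m a b /=; rewrite actBl mulrzBl.
- by move=> i j k e a x y /=; rewrite actBr mulrzBl.
- move=> i j k ij jk l e1 e2 e3 e4 a b m /=.
  rewrite (actA _ _ (shift_act_eq n e3) (shift_act_eq n e4)) actMz -mulrzA -sgnM.
  by congr (_ *~ ((-1) ^ _)); rewrite -e1 mulrDr addrC.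
- by move=> i e m /=; rewrite mulr0 expr0z mulr1z act1.
- move=> i j k i' j' l e ei ej ek e1 e2 a m /=.
  rewrite raddfMz /= (act_d _ ei (shift_d_eq n ej) _ (shift_act_eq n e1)
    (shift_act_eq n e2)) !mulrzDl actMz.
  congr (_ + _); rewrite -!mulrzA; congr (_ *~ _).
    by rewrite -ei mulrDr mulr1 sgnM.
  by rewrite mulrA [LHS]mulrC; congr (_ * _); rewrite mulrC.
Defined.

Definition shift_hom n M N (f : dghom M N) : dghom (shift n M) (shift n N).
Proof.
unshelve eexists.
  exists (fun i => f (i + n)) => [i x y|i j ij x] /=; first exact: cmB.
  by rewrite raddfMz /= cm_d.
by move=> i j k e a m /=; rewrite raddfMz /= dh_act.
Defined.

Definition dsum_cx (C D : complex) : complex.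
Proof.
exists (fun i => (C i * D i)%type : zmodType)
  (fun i j ij x => (cd ij x.1, cd ij x.2)).
- by move=> i j ij x y; rewrite /= !cdB.
- by move=> i j k ij jk x; rewrite /= !cdd.
Defined.

Definition dsum M N : dgmod A.
Proof.
exists (dsum_cx M N) (fun i j k e a x => (act e a x.1, act e a x.2)).
- by move=> i j k e m a b; rewrite /= !actBl.
- by move=> i j k e m a b; rewrite /= !actBr.
- by move=> i j k ij jk l e1 e2 e3 e4 a b m /=; rewrite !(actA e1 e2 e3 e4).
- by move=> i e [x y]; rewrite /= !act1.
- move=> i j k i' j' l e ei ej ek e1 e2 a m /=.
  by rewrite !(act_d e ei ej ek e1 e2); apply/pair_equal_spec; split => //=;
    rewrite raddfMz.
Defined.

(* Mapping cone: Cone(f) = M[1] (+) N with d (m, x) = (d m, f m + d x); the   *)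
(* term f m sits in degree i + 1 and is transported along i + 1 = j.          *)
Section Cone.
Variables (M N : dgmod A) (f : dghom M N).

Definition cone_d i j (ij : i + 1 = j) (x : (shift 1 M i * N i)%type) :
    (shift 1 M j * N j)%type :=
  (cd ij x.1, ecast z (N z) ij (f (i + 1) x.1) + cd ij x.2).

Lemma cone_dB i j (ij : i + 1 = j) : {morph cone_d ij : x y / x - y}.
Proof.
case: _ / ij => -[m x] [m' x']; rewrite /cone_d /= !cdB mulrzBl cmB.
by apply/pair_equal_spec; split => //=; rewrite addrACA opprD.
Qed.

Lemma cone_dd i j k (ij : i + 1 = j) (jk : j + 1 = k) x :
  cone_d jk (cone_d ij x) = 0.
Proof.
apply/pair_equal_spec; split; first exact: (@cdd (shift_cx 1 M)).
case: _ / jk; case: _ / ij; rewrite /= raddfD /= cdd addr0 raddfMz /= cm_d.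
rewrite -(eq_irrelevance (erefl _) (shift_d_eq 1 (erefl (i + 1)))).
by rewrite expr1z mulrN1z addNr.
Qed.

Definition cone_cx : complex :=
  @Complex (fun i => (shift 1 M i * N i)%type : zmodType) cone_d cone_dB cone_dd.

Lemma ecast_act i j j' k k' (e : i + j = k) (ej : j = j') (ek : k = k')
    (e' : i + j' = k') (a : A i) (x : N j) :
  ecast z (N z) ek (act e a x) = act e' a (ecast z (N z) ej x).
Proof.
by move: e'; case: _ / ek; case: _ / ej => e'; rewrite (eq_irrelevance e' e).
Qed.

Definition cone : dgmod A.
Proof.
exists cone_cx (fun i j k e a x => (act e a x.1, act e a x.2)).
- by move=> i j k e m a b; rewrite /= !actBl mulrzBl.
- by move=> i j k e m a b; rewrite /= !actBr mulrzBl.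
- move=> i j k ij jk l e1 e2 e3 e4 a b m.
  by rewrite !(@actA _ (shift 1 M) _ _ _ _ _ _ e1 e2 e3 e4) !(actA e1 e2 e3 e4).
- move=> i e [x y]; rewrite !act1; congr pair; exact: (@act1 _ (shift 1 M)).
- move=> i j k i' j' l e ei ej ek e1 e2 a [m x].
  apply/pair_equal_spec; split.
    rewrite [LHS](@act_d _ (shift 1 M) _ _ _ _ _ _ e ei ej ek e1 e2).
    by rewrite /= [in RHS]raddfMz.
  rewrite /= [RHS]/= [in RHS]raddfMz /= raddfMz /= dh_act.
  rewrite (act_d e ei ej ek e1 e2) actD mulrzDl addrCA; congr (_ + (_ + _)).
  rewrite -(ecast_act (shift_act_eq 1 e) ej ek e2) mul1r.
  by case: _ / ek.
Defined.

Definition cone_in : dghom N cone.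
Proof.
unshelve eexists.
  exists (fun i (x : N i) => (0, x) : cone_cx i) => [i x y|i j ij x].
    by apply/pair_equal_spec; rewrite /= subr0.
  apply/pair_equal_spec; split; first by rewrite /= raddf0 mul0rz.
  by rewrite /= raddf0; case: _ / ij => /=; rewrite add0r.
move=> i j k e a x; apply/pair_equal_spec; split=> //=.
by rewrite act0 mul0rz.
Defined.

Definition cone_out : dghom cone (shift 1 M).
Proof.
unshelve eexists.
  by exists (fun i (x : cone_cx i) => x.1 : shift 1 M i).
by [].
Defined.
End Cone.

Lemma quasi_iso_shift n M N (f : dghom M N) :
  quasi_iso f -> quasi_iso (shift_hom n f).
Proof.
have sK (V : zmodType) : involutive (fun x : V => x *~ (-1) ^ n).
  by move=> x; rewrite -mulrzA sgn_sq.
move=> /quasi_isoP qf; apply/quasi_isoP => h i j hi ij.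
have [inj sur] := qf _ _ _ (shift_d_eq n hi) (shift_d_eq n ij).
split=> [x /= /(congr1 (fun z => z *~ (-1) ^ n)) | y /=].
  rewrite sK mul0rz => xZ [y e].
  have [|z ->] := inj _ xZ; first by exists (y *~ (-1) ^ n); rewrite raddfMz.
  by exists (z *~ (-1) ^ n); rewrite raddfMz sK.
move/(congr1 (fun z => z *~ (-1) ^ n)); rewrite sK mul0rz => yZ.
have [x xZ [z e]] := sur _ yZ; exists x; first by rewrite xZ mul0rz.
by exists (z *~ (-1) ^ n); rewrite raddfMz sK.
Qed.
End DGModules.

Section Restriction.
Variables (A B : cdgring) (f : dgrhom A B) (M : dgmod B).

Definition restrict : dgmod A.
Proof.
exists M (fun i j k e a m => act e (f i a) m).
- by move=> i j k e m a b; rewrite /= cmB actBl.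
- by move=> i j k e a x y; rewrite /= actBr.
- by move=> i j k ij jk l e1 e2 e3 e4 a b m; rewrite rhM (actA e1 e2 e3 e4).
- by move=> i e m; rewrite rh1 act1.
- move=> i j k i' j' l e ei ej ek e1 e2 a m.
  by rewrite cm_d (act_d e ei ej ek e1 e2).
Defined.
End Restriction.

Definition Hbar_mod (A : cdgring) : dgmod A :=
  restrict (canon A) (regular_mod (dgring_of_ring (Hbar A))).

(* D(A) is the localization of the category of DG A-modules and degree 0      *)
(* homomorphisms at the quasi-isomorphisms: its morphisms are the formal      *)
(* composites dmor, taken modulo the congruence deq.                          *)
Section DerivedCategory.
Variable A : cdgring.
Implicit Types L M N P Q : dgmod A.

Inductive dmor : dgmod A -> dgmod A -> Type :=
| dhom M N (f : dghom M N) : dmor M N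
| dinv M N (f : dghom M N) (qf : quasi_iso f) : dmor N M
| dcomp L M N (v : dmor M N) (u : dmor L M) : dmor L N.

Definition did M : dmor M M := dhom (dghom_id M).

Inductive deq : forall M N, dmor M N -> dmor M N -> Prop :=
| deq_refl M N (u : dmor M N) : deq u u
| deq_sym M N (u v : dmor M N) : deq u v -> deq v u
| deq_trans M N (u v w : dmor M N) : deq u v -> deq v w -> deq u w
| deq_comp L M N (v v' : dmor M N) (u u' : dmor L M) :
    deq v v' -> deq u u' -> deq (dcomp v u) (dcomp v' u')
| deq_compA L M N P (w : dmor N P) (v : dmor M N) (u : dmor L M) :
    deq (dcomp w (dcomp v u)) (dcomp (dcomp w v) u)
| deq_id_l M N (u : dmor M N) : deq (dcomp (did N) u) u
| deq_id_r M N (u : dmor M N) : deq (dcomp u (did M)) u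
| deq_hom M N (f g : dghom M N) :
    (forall i x, f i x = g i x) -> deq (dhom f) (dhom g)
| deq_hom_comp L M N (g : dghom M N) (f : dghom L M) :
    deq (dhom (dghom_comp g f)) (dcomp (dhom g) (dhom f))
| deq_inv_l M N (f : dghom M N) (qf : quasi_iso f) :
    deq (dcomp (dinv qf) (dhom f)) (did M)
| deq_inv_r M N (f : dghom M N) (qf : quasi_iso f) :
    deq (dcomp (dhom f) (dinv qf)) (did N).

Definition d_is_iso M N (u : dmor M N) : Prop :=
  exists v : dmor N M, deq (dcomp v u) (did M) /\ deq (dcomp u v) (did N).

Definition d_iso M N : Prop := exists u : dmor M N, d_is_iso u.

Fixpoint dshift (n : int) M N (u : dmor M N) : dmor (shift n M) (shift n N) :=
  match u with
  | dhom _ _ f => dhom (shift_hom n f)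
  | dinv _ _ _ qf => dinv (@quasi_iso_shift A n _ _ _ qf)
  | dcomp _ _ _ v u => dcomp (dshift n v) (dshift n u)
  end.

Definition distinguished L M N (u : dmor L M) (v : dmor M N)
    (w : dmor N (shift 1 L)) : Prop :=
  exists (P Q : dgmod A) (f : dghom P Q)
    (a : dmor L P) (b : dmor M Q) (c : dmor N (cone f)),
  [/\ [/\ d_is_iso a, d_is_iso b & d_is_iso c],
      deq (dcomp b u) (dcomp (dhom f) a),
      deq (dcomp c v) (dcomp (dhom (cone_in f)) b) &
      deq (dcomp (dshift 1 a) w) (dcomp (dhom (cone_out f)) c)].

(* Every morphism of D(A) is allowed as u, not only classes of homomorphisms. *)
Definition is_cone L M (u : dmor L M) N : Prop :=
  exists v w, @distinguished L M N u v w.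

(* A direct summand of N in D(A) is an M with N isomorphic in D(A) to some    *)
(* dsum M M', so it is covered by perfect_summand together with perfect_iso.  *)
Inductive perfect : dgmod A -> Prop :=
| perfect_regular : perfect (regular_mod A)
| perfect_shift n M : perfect M -> perfect (shift n M)
| perfect_cone L M N (u : dmor L M) :
    perfect L -> perfect M -> is_cone u N -> perfect N
| perfect_summand M N : perfect (dsum M N) -> perfect M
| perfect_iso M N : d_iso M N -> perfect M -> perfect N.
End DerivedCategory.

Section CommutativeAlgebra.
Variable R : comPzRingType.

Definition is_unit (u : R) : Prop := exists v, u * v = 1.

Definition is_ideal (I : R -> Prop) : Prop :=
  [/\ I 0, forall x y, I x -> I y -> I (x + y) & forall a x, I x -> I (a * x)].

Definition generates n (g : 'I_n -> R) (I : R -> Prop) : Prop :=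
  forall x, I x <-> exists c : 'I_n -> R, x = \sum_(i < n) c i * g i.

Definition noetherian : Prop :=
  forall I, is_ideal I -> exists n (g : 'I_n -> R), generates g I.

Definition is_prime (I : R -> Prop) : Prop :=
  [/\ is_ideal I, ~ I 1 & forall x y, I (x * y) -> I x \/ I y].

Definition is_maximal (I : R -> Prop) : Prop :=
  [/\ is_ideal I, ~ I 1 &
      forall J, is_ideal J -> ~ J 1 -> (forall x, I x -> J x) ->
        forall x, J x -> I x].

Definition prime_chain n (p : 'I_n.+1 -> R -> Prop) : Prop :=
  (forall i, is_prime (p i)) /\
  (forall i j : 'I_n.+1, (i < j)%N ->
     (forall x, p i x -> p j x) /\ exists2 x, p j x & ~ p i x).

Definition krull_dim_le n : Prop :=
  forall m (p : 'I_m.+1 -> R -> Prop), prime_chain p -> (m <= n)%N.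

Definition krull_dim n : Prop :=
  krull_dim_le n /\ exists p : 'I_n.+1 -> R -> Prop, prime_chain p.

Definition finite_dim : Prop := exists n, krull_dim_le n.

Definition local_with (m : R -> Prop) : Prop :=
  is_maximal m /\ forall m', is_maximal m' -> forall x, m' x <-> m x.

Definition regular_local : Prop :=
  noetherian /\
  exists m n (g : 'I_n -> R), [/\ local_with m, krull_dim n & generates g m].

Definition mult_closed (S : R -> Prop) : Prop :=
  S 1 /\ forall x y, S x -> S y -> S (x * y).
End CommutativeAlgebra.

(* For a ring homomorphism f these three conditions say that the induced map  *)
(* S^-1 R -> L is well defined, surjective and injective.                     *)
Definition is_localization (R L : comPzRingType) (S : R -> Prop) (f : R -> L) :
    Prop :=
  [/\ forall s, S s -> is_unit (f s),
      forall x, exists r s, S s /\ x * f s = f r &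
      forall r, f r = 0 -> exists2 s, S s & s * r = 0].

Definition regular_ring (K : comPzRingType) : Prop :=
  noetherian K /\
  forall p : K -> Prop, is_prime p ->
    exists (L : comPzRingType) (f : {rmorphism K -> L}),
      is_localization (fun s => ~ p s) f /\ regular_local L.

Definition finitely_generated_ring (K B : comPzRingType) (g : K -> B) : Prop :=
  exists n (b : 'I_n -> B), forall P : B -> Prop,
    (forall a, P (g a)) -> (forall i, P (b i)) ->
    (forall x y, P x -> P y -> P (x - y)) ->
    (forall x y, P x -> P y -> P (x * y)) -> forall x, P x.

Definition essentially_finite_type (K L : comPzRingType) (h : K -> L) : Prop :=
  exists (B : comPzRingType) (g : {rmorphism K -> B}) (S : B -> Prop)
    (f : {rmorphism B -> L}),
  [/\ finitely_generated_ring g, mult_closed S, is_localization S f &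
      forall a, h a = f (g a)].

Definition finitely_generated_mod (R : pzRingType) (V : lmodType R) : Prop :=
  exists n (g : 'I_n -> V), forall x, exists c : 'I_n -> R,
    x = \sum_(i < n) c i *: g i.

Definition cohomologically_bounded (A : cdgring) : Prop :=
  exists s : seq int, forall i, i \notin s -> forall u : coh A i, u = 0.

Definition cohomologically_pseudo_noetherian (A : cdgring) : Prop :=
  noetherian (Hbar A) /\ forall i, finitely_generated_mod (coh A i).

Definition induced (K : comPzRingType) (A : cdgring)
    (f : dgrhom (dgring_of_ring K) A) (a : K) : Hbar A :=
  deg0_class (f 0 (conc_in a)).

Definition tractable (A : cdgring) : Prop :=
  cohomologically_pseudo_noetherian A /\
  exists (K : comPzRingType) (f : dgrhom (dgring_of_ring K) A),
    [/\ finite_dim K, regular_ring K & essentially_finite_type (induced f)].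

(* Main.v *)
(* Suppose H^i(A) <> 0 for some i < 0 and let i0 be the lowest such degree.   *)
(* Choose z in H^i0(A) whose annihilator p in Hbar is maximal, hence prime,   *)
(* and work locally at p, i.e. up to factors t with t z <> 0.  An argument of *)
(* Auslander-Buchsbaum type applies to the perfect module Hbar: attach cells  *)
(* along minimal local generators of its top cohomology, and repeat.  Hbar    *)
(* has finite projective dimension, so eventually a module is reached that is *)
(* locally a direct summand of a free one, and z e <> 0 for a generator e of  *)
(* its top cohomology.  By minimality of the generators, z e is killed by     *)
(* each attaching map, so it lifts back, one degree lower per step, to a      *)
(* nonzero class of Hbar in degree <= i0 < 0: a contradiction.                *)
From mathcomp Require Import all_boot all_order all_algebra.
From mathcomp Require Import boolp zify ring.
Require Import Defs.
Set Implicit Arguments.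
Unset Strict Implicit.
Unset Printing Implicit Defensive.
Import Order.TTheory GRing.Theory Num.Theory.
Local Open Scope ring_scope.

(** A nonzero perfect module is at least as wide, in cohomological degrees, as [A] itself, whereas
    Hbar occupies the single degree 0. If [A] had cohomology in negative degrees, boundedness would
    give a lowest such degree [i0] ([lowest_cohomology]), and noetherianity of Hbar a class z in
    that degree whose annihilator p is prime ([associated_prime_class]). The width estimate is
    [detected_ext_vanish]: a module with noetherian cohomology that vanishes locally above degree c,
    is not locally acyclic and has finite local projective dimension carries a nonzero class in some
    degree at most [i0] + c. For Hbar and c = 0 this is absurd, as [i0] < 0
    ([perfect_lowest_class]); hence [A] has cohomology only in degree 0 and [canon_quasi_iso]
    concludes.

    Two devices keep the argument inside DG [A]-modules. Localization at p is never formed: [tors]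
    says that a class dies after multiplication by some element outside p, and [local_qiso] is the
    matching notion of isomorphism. Projective dimension is replaced by [ext_vanish], the local
    vanishing of all morphisms to modules with cohomology below a bound; it is stable under every
    operation that builds perfect modules ([perfect_ext_vanish]).

    The estimate is by induction on the gap between the top degree and that bound. Passing to the
    cone over a minimal free cover of the top cohomology lowers the top degree and keeps the bound.
    Minimality puts the coefficients of every relation into p, so z kills them; this is what lets
    classes of the cone come back to the module ([act_z_cone], [below_cone]). When the gap is zero
    the module is locally a summand of its free cover, and z acts nontrivially on the generators
    ([ext_vanish_attach]). *)

(** * Cocycles, boundaries and scalars of degree 0 *)

Section Cocycles.
Variable C : complex.
Implicit Types i j h : int.

(** Cohomology is handled below through predicates on elements, with equality of classes expressed
    by [bdry] of a difference; this avoids choosing representatives. *)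
Definition cocyc i (x : C i) : Prop := cd (erefl (i + 1)) x = 0.
Definition bdry i (x : C i) : Prop := exists y : C (i - 1), x = cd (subrK 1 i) y.

Lemma cocycE i j (ij : i + 1 = j) (x : C i) : cocyc x -> cd ij x = 0.
Proof. by case: _ / ij. Qed.

Lemma cocycI i j (ij : i + 1 = j) (x : C i) : cd ij x = 0 -> cocyc x.
Proof. by case: _ / ij. Qed.

Lemma bdryE h i (hi : h + 1 = i) (x : C i) :
  bdry x -> exists y : C h, x = cd hi y.
Proof.
have hE : h = i - 1 by rewrite -hi addrK.
move: hi; rewrite hE => hi [y ->]; exists y.
by rewrite (eq_irrelevance hi (subrK 1 i)).
Qed.

Lemma bdryI h i (hi : h + 1 = i) (y : C h) : bdry (cd hi y).
Proof.
have hE : h = i - 1 by rewrite -hi addrK.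
move: hi y; rewrite hE => hi y; exists y.
by rewrite (eq_irrelevance hi (subrK 1 i)).
Qed.

Lemma bdry_cocyc i (x : C i) : bdry x -> cocyc x.
Proof. by case=> y ->; apply: cdd. Qed.

Lemma cocyc0 i : cocyc (0 : C i).
Proof. exact: raddf0. Qed.

Lemma cocycB i (x y : C i) : cocyc x -> cocyc y -> cocyc (x - y).
Proof. by rewrite /cocyc cdB => -> ->; rewrite subrr. Qed.

Lemma cocycN i (x : C i) : cocyc x -> cocyc (- x).
Proof. by rewrite -sub0r => xZ; apply: cocycB => //; apply: cocyc0. Qed.

Lemma cocycD i (x y : C i) : cocyc x -> cocyc y -> cocyc (x + y).
Proof. by rewrite -{2}(opprK y) => xZ /cocycN; apply: cocycB. Qed.

Lemma bdry0 i : bdry (0 : C i).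
Proof. by exists 0; rewrite raddf0. Qed.

Lemma bdryB i (x y : C i) : bdry x -> bdry y -> bdry (x - y).
Proof. by case=> a -> [b ->]; exists (a - b); rewrite raddfB. Qed.

Lemma bdryN i (x : C i) : bdry x -> bdry (- x).
Proof. by rewrite -sub0r => xZ; apply: bdryB => //; apply: bdry0. Qed.

Lemma bdryD i (x y : C i) : bdry x -> bdry y -> bdry (x + y).
Proof. by rewrite -{2}(opprK y) => xZ /bdryN; apply: bdryB. Qed.

Lemma bdryMz i (x : C i) n : bdry x -> bdry (x *~ n).
Proof. by case=> y ->; exists (y *~ n); rewrite raddfMz. Qed.

Lemma mulrz_sgnK (V : zmodType) (n : int) : involutive (fun x : V => x *~ (-1) ^ n).
Proof. by move=> x; rewrite -mulrzA sgn_sq. Qed.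

Lemma bdry_sgn i (x : C i) (n : int) : bdry (x *~ (-1) ^ n) -> bdry x.
Proof. by move/(@bdryMz _ _ ((-1) ^ n)); rewrite mulrz_sgnK. Qed.

Lemma bdry_cong i (x y : C i) : bdry (x - y) -> bdry y -> bdry x.
Proof. by move=> xy /(bdryD xy); rewrite subrK. Qed.

End Cocycles.

Lemma chmap_cocyc (C D : complex) (f : chmap C D) i (x : C i) :
  cocyc x -> cocyc (f i x).
Proof. by move=> xZ; rewrite /cocyc -cm_d (cocycE _ xZ) raddf0. Qed.

Lemma chmap_bdry (C D : complex) (f : chmap C D) i (x : C i) :
  bdry x -> bdry (f i x).
Proof. by case=> y ->; rewrite cm_d; apply: bdryI. Qed.

Section Scalars.
Variable A : cdgring.
Implicit Types (M N : dgmod A) (i j k : int).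

Lemma act0l M i j k (e : i + j = k) (x : M j) : act e (0 : A i) x = 0.
Proof. by rewrite -(subrr 0) actBl subrr. Qed.

Lemma actNl M i j k (e : i + j = k) (a : A i) (x : M j) :
  act e (- a) x = - act e a x.
Proof. by rewrite -sub0r actBl act0l sub0r. Qed.

Lemma actDl M i j k (e : i + j = k) (a b : A i) (x : M j) :
  act e (a + b) x = act e a x + act e b x.
Proof. by rewrite -{1}(opprK b) actBl actNl opprK. Qed.

Lemma actMnl M i j k (e : i + j = k) (a : A i) (x : M j) n :
  act e (a *+ n) x = act e a x *+ n.
Proof. by elim: n => [|n IHn]; rewrite ?mulr0n ?act0l // !mulrS actDl IHn. Qed.

Lemma actMzl M i j k (e : i + j = k) (a : A i) (x : M j) (n : int) :
  act e (a *~ n) x = act e a x *~ n.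
Proof. by case: n => n; rewrite ?NegzE ?mulrNz ?actNl -!pmulrn actMnl. Qed.

Lemma act_sum M i j k (e : i + j = k) (a : A i) (I : finType) (F : I -> M j) :
  act e a (\sum_l F l) = \sum_l act e a (F l).
Proof. by apply: (big_morph (act e a)) => [x y|]; rewrite ?actD ?act0. Qed.

Lemma act_cocyc M i j k (e : i + j = k) (a : A i) (x : M j) :
  cocyc a -> cocyc x -> cocyc (act e a x).
Proof.
move=> aZ xZ; have e1 : i + 1 + j = k + 1 by rewrite -e addrAC.
have e2 : i + (j + 1) = k + 1 by rewrite -e addrA.
rewrite /cocyc (act_d e erefl erefl _ e1 e2).
by rewrite (cocycE _ aZ) (cocycE _ xZ) act0l act0 mul0rz addr0.
Qed.

Lemma act_bdryr M i j k (e : i + j = k) (a : A i) (x : M j) :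
  cocyc a -> bdry x -> bdry (act e a x).
Proof.
move=> aZ [y ->]; have e1 : i + 1 + (j - 1) = k.
  by rewrite -e addrACA subrr addr0.
have e2 : i + (j - 1) = k - 1 by rewrite -e addrA.
have := act_d e2 erefl (subrK 1 j) (subrK 1 k) e1 e a y.
rewrite (cocycE _ aZ) act0l add0r => E; apply: (@bdry_sgn _ _ _ i).
by rewrite -E; apply: bdryI.
Qed.

Lemma act_bdryl M i j k (e : i + j = k) (a : A i) (x : M j) :
  bdry a -> cocyc x -> bdry (act e a x).
Proof.
move=> [b ->] xZ; have e1 : i - 1 + j = k - 1 by rewrite -e addrAC.
have e2 : i - 1 + (j + 1) = k by rewrite -e addrACA addNr addr0.
have := act_d e1 (subrK 1 i) erefl (subrK 1 k) e e2 b x.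
by rewrite (cocycE _ xZ) act0 mul0rz addr0 => <-; apply: bdryI.
Qed.

Lemma bdry_act_irr M i j k k' (e : i + j = k) (e' : i + j = k') (a : A i) (x : M j) :
  bdry (act e a x) -> bdry (act e' a x).
Proof. by case: _ / e; case: _ / e'. Qed.

Lemma cocyc_deg0 (t : A 0) : cocyc t.
Proof. by apply: dgr_nonpos. Qed.

(* Locked, so that matching cannot unfold a scalar multiple into a pair.      *)
Definition sc M i (t : A 0) (x : M i) : M i := locked (act (add0r i) t x).

Lemma scE M i (e : 0 + i = i) t (x : M i) : act e t x = sc t x.
Proof. by rewrite /sc -lock (eq_irrelevance e (add0r i)). Qed.

Lemma sc0 M i t : sc t (0 : M i) = 0.
Proof. by rewrite -!(scE (add0r _)); apply: act0. Qed.
Lemma scD M i t (x y : M i) : sc t (x + y) = sc t x + sc t y.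
Proof. by rewrite -!(scE (add0r _)); apply: actD. Qed.
Lemma scB M i t (x y : M i) : sc t (x - y) = sc t x - sc t y.
Proof. by rewrite -!(scE (add0r _)); apply: actBr. Qed.
Lemma scN M i t (x : M i) : sc t (- x) = - sc t x.
Proof. by rewrite -!(scE (add0r _)); apply: actN. Qed.
Lemma scMz M i t (x : M i) n : sc t (x *~ n) = sc t x *~ n.
Proof. by rewrite -!(scE (add0r _)); apply: actMz. Qed.
Lemma sc0l M i (x : M i) : sc 0 x = 0.
Proof. by rewrite -!(scE (add0r _)); apply: act0l. Qed.
Lemma scBl M i s t (x : M i) : sc (s - t) x = sc s x - sc t x.
Proof. by rewrite -!(scE (add0r _)); apply: actBl. Qed.
Lemma sc1 M i (x : M i) : sc (dgr1 A) x = x.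
Proof. by rewrite -!(scE (add0r _)); apply: act1. Qed.

Definition mul0 (s t : A 0) : A 0 := dgrM (addr0 0) s t.

Lemma mul0C s t : mul0 s t = mul0 t s.
Proof. by rewrite {1}/mul0 (dgrMC (addr0 0)) mul0r expr0z mulr1z. Qed.

Lemma scM M i s t (x : M i) : sc (mul0 s t) x = sc s (sc t x).
Proof. by rewrite -!(scE (add0r _)); apply: actA. Qed.

Lemma scC M i s t (x : M i) : sc s (sc t x) = sc t (sc s x).
Proof. by rewrite -!scM mul0C. Qed.

Lemma dh_sc M N (f : dghom M N) i t (x : M i) : f i (sc t x) = sc t (f i x).
Proof. by rewrite -!(scE (add0r _)); apply: dh_act. Qed.

Lemma sc_act M i j k (e : i + j = k) t (a : A i) (x : M j) :
  sc t (act e a x) = act e a (sc t x).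
Proof.
rewrite -!(scE (add0r _)) -(actA (add0r i) e e (add0r k)) -(actA (addr0 i) e (add0r j) e).
by congr act; rewrite (dgrMC (addr0 i)) mulr0 expr0z mulr1z.
Qed.

Lemma sc_cd M i j (ij : i + 1 = j) t (x : M i) : cd ij (sc t x) = sc t (cd ij x).
Proof.
have e1 : 1 + i = j by rewrite addrC.
rewrite -!(scE (add0r _)) (act_d (add0r i) (add0r 1) ij ij e1 (add0r j)).
by rewrite (cocycE _ (cocyc_deg0 t)) act0l add0r expr0z mulr1z.
Qed.

Lemma sc_cocyc M i t (x : M i) : cocyc x -> cocyc (sc t x).
Proof. by rewrite -(scE (add0r _)); apply: act_cocyc; apply: cocyc_deg0. Qed.

Lemma sc_bdry M i t (x : M i) : bdry x -> bdry (sc t x).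
Proof. by rewrite -(scE (add0r _)); apply: act_bdryr; apply: cocyc_deg0. Qed.

Lemma sc_shift n M i t (x : shift n M i) : sc t x = sc t (x : M (i + n)).
Proof. by rewrite -(scE (add0r _)) /= mulr0 expr0z mulr1z scE. Qed.

Lemma sc_dsum M N i t (x : dsum M N i) : sc t x = (sc t x.1, sc t x.2).
Proof. by rewrite -!(scE (add0r _)). Qed.

Lemma sc_cone M N (f : dghom M N) i t (m : M (i + 1)) (n : N i) :
  sc t ((m, n) : cone f i) = ((sc t m, sc t n) : cone f i).
Proof. by rewrite -(@sc_shift 1 M i t m) -!(scE (add0r _)). Qed.

End Scalars.

Section ShiftCocycles.
Variables (A : cdgring) (n : int) (M : dgmod A) (i : int) (x : shift n M i).

Lemma cocyc_shift : cocyc x <-> cocyc (x : M (i + n)).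
Proof.
split=> [|xZ]; last by rewrite /cocyc /= (cocycE _ xZ) mul0rz.
by move/(congr1 (fun y => y *~ (-1) ^ n)); rewrite /= mulrz_sgnK mul0rz => /cocycI.
Qed.

Lemma bdry_shift : bdry x <-> bdry (x : M (i + n)).
Proof.
split=> [[y ->]|]; first by apply: bdryMz; apply: bdryI.
case/(bdryE (shift_d_eq n (subrK 1 i))) => y yE.
by exists (y *~ (-1) ^ n); rewrite /= raddfMz mulrz_sgnK.
Qed.
End ShiftCocycles.

(** * Cones and their functoriality *)

(** Writing a degree as [h + 1] makes the preceding degree literally [h], so that boundaries can be
    written without transport. *)
Lemma succ_ind (P : int -> Prop) : (forall h, P (h + 1)) -> forall i, P i.
Proof. by move=> PS i; have := PS (i - 1); rewrite subrK. Qed.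

Lemma cdMz (C : complex) i j (ij : i + 1 = j) (x : C i) n :
  cd ij (x *~ n) = cd ij x *~ n.
Proof. exact: raddfMz. Qed.

Lemma cmMz (C D : complex) (f : chmap C D) i (x : C i) n :
  f i (x *~ n) = f i x *~ n.
Proof. exact: raddfMz. Qed.

Lemma cm_sum (C D : complex) (f : chmap C D) i (I : finType) (F : I -> C i) :
  f i (\sum_l F l) = \sum_l f i (F l).
Proof. exact: raddf_sum. Qed.

Lemma cmN (C D : complex) (f : chmap C D) i (x : C i) : f i (- x) = - f i x.
Proof. exact: raddfN. Qed.

Lemma cd_ecast (C : complex) i i' j j' (ij : i + 1 = j) (ij' : i' + 1 = j')
    (ei : i = i') (ej : j = j') (x : C i) :
  cd ij' (ecast k (C k) ei x) = ecast k (C k) ej (cd ij x).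
Proof.
by case: _ / ei ij'; case: _ / ej => ij'; rewrite (eq_irrelevance ij' ij).
Qed.

Lemma ecastB (C : complex) i j (e : i = j) :
  {morph (fun x : C i => ecast k (C k) e x) : x y / x - y}.
Proof. by case: _ / e. Qed.

Lemma ecast0 (C : complex) i j (e : i = j) : ecast k (C k) e 0 = 0.
Proof. by case: _ / e. Qed.

Lemma ecastMz (C : complex) i j (e : i = j) (x : C i) n :
  ecast k (C k) e (x *~ n) = ecast k (C k) e x *~ n.
Proof. by case: _ / e. Qed.

Lemma ecast_ecast (C : complex) i j k (e1 : i = j) (e2 : j = k) (e3 : i = k)
    (x : C i) :
  ecast l (C l) e2 (ecast l (C l) e1 x) = ecast l (C l) e3 x.
Proof. by case: _ / e2 e3; case: _ / e1 => e3; rewrite (eq_irrelevance e3 erefl). Qed.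

Lemma cm_ecast (C D : complex) (f : chmap C D) i j (e : i = j) (x : C i) :
  f j (ecast k (C k) e x) = ecast k (D k) e (f i x).
Proof. by case: _ / e. Qed.

Lemma ecast_shift n (C : complex) i j (e : i = j) (e' : i + n = j + n)
    (x : C (i + n)) :
  ecast k (C k) e' x = ecast k (C (k + n)) e x.
Proof. by case: _ / e e' => e'; rewrite (eq_irrelevance e' erefl). Qed.

Section ConeMaps.
Variable A : cdgring.
Implicit Types M N X : dgmod A.

Lemma cone_cocyc M N (f : dghom M N) i (m : M (i + 1)) (n : N i) :
  cocyc ((m, n) : cone f i) <-> cocyc m /\ f _ m + cd erefl n = 0.
Proof.
rewrite /cocyc /= /cone_d /=; split=> [[m0 n0]|[m0 n0]].
  by split=> //; exact: ((@cocyc_shift _ 1 M i m).1 m0).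
by apply/pair_equal_spec; split=> //; exact: ((@cocyc_shift _ 1 M i m).2 m0).
Qed.

Lemma cone_bdryI M N (f : dghom M N) h (m : M (h + 1)) (n : N h) :
  bdry ((- cd erefl m, f _ m + cd erefl n) : cone f (h + 1)).
Proof.
have := @bdryI (cone f) h (h + 1) erefl (m, n).
rewrite /= /cone_d /= expr1z mulrN1z.
by rewrite (eq_irrelevance (shift_d_eq 1 erefl) (erefl (h + 1 + 1))).
Qed.

Lemma cone_bdryE M N (f : dghom M N) h (m : M (h + 1 + 1)) (n : N (h + 1)) :
  bdry ((m, n) : cone f (h + 1)) ->
  exists m' n', m = - cd erefl m' /\ n = f _ m' + cd erefl n'.
Proof.
case/(bdryE (erefl (h + 1))) => -[m' n'] [-> ->]; exists m', n'; split=> //.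
rewrite expr1z mulrN1z.
by rewrite (eq_irrelevance (shift_d_eq 1 erefl) (erefl (h + 1 + 1))).
Qed.

(** Exactness of the long cohomology sequence at the cone; this is the tool by which classes are
    brought back from a cone to [N]. *)
Lemma cone_exact M N (f : dghom M N) i (x : cone f i) :
  cocyc x -> bdry (cone_out f i x) ->
  exists2 y, cocyc y & bdry (x - cone_in f i y).
Proof.
elim/succ_ind: i x => h [m n] /cone_cocyc[mZ mn].
case/(@bdry_shift _ 1 M)/(bdryE erefl) => m' mE.
(* Adding the cone boundary of (m', 0), which is (- d m', f m'), cancels the first coordinate. *)
exists (n + f _ m'); first by rewrite /cocyc raddfD /= -cm_d -mE [LHS]addrC mn.
have := cone_bdryI f m' 0 => /bdryN; congr bdry.
apply/pair_equal_spec; split => /=.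
  by rewrite opprK -mE; apply/esym; apply: subr0.
by rewrite raddf0 addr0 opprD addrA subrr sub0r.
Qed.

Section Functoriality.
Variables (M N M' N' : dgmod A) (f : dghom M N) (f' : dghom M' N').
Variables (a : dghom M M') (b : dghom N N').
Hypothesis sq : forall i x, f' i (a i x) = b i (f i x).

Definition cone_map : dghom (cone f) (cone f').
Proof.
unshelve eexists.
  exists (fun i (x : cone f i) => (a _ x.1, b _ x.2) : cone f' i) => [i x y|i j ij x].
    by rewrite /= !cmB.
  case: _ / ij; apply/pair_equal_spec; split.
    by rewrite /= raddfMz /= cm_d.
  by rewrite /= raddfD /= cm_d sq.
move=> i j k e s x; apply/pair_equal_spec; split; last exact: dh_act.
by rewrite /= raddfMz /= dh_act.
Defined.
End Functoriality.

Section Extension.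
Variables (M N X : dgmod A) (f : dghom M N) (k : dghom N X).
Hypothesis kf0 : forall i x, k i (f i x) = 0.

(** The extension by zero on the summand coming from [M]; it needs the composite to vanish strictly,
    not only up to homotopy. *)
Definition cone_factor : dghom (cone f) X.
Proof.
unshelve eexists.
  exists (fun i (x : cone f i) => k _ x.2) => [i x y|i j ij x].
    by rewrite /= cmB.
  by case: _ / ij; rewrite /= raddfD /= kf0 add0r cm_d.
by move=> i j l e s x; rewrite /= dh_act.
Defined.
End Extension.

Section DsumMaps.
Variables M N X : dgmod A.

Definition dsum_inl : dghom M (dsum M N).
Proof.
unshelve eexists.
  exists (fun i (x : M i) => (x, 0) : dsum M N i) => [i x y|i j ij x].
    by apply/pair_equal_spec; rewrite /= subr0.
  by rewrite /= raddf0.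
by move=> i j k e a x; rewrite /= act0.
Defined.

Definition dsum_inr : dghom N (dsum M N).
Proof.
unshelve eexists.
  exists (fun i (x : N i) => (0, x) : dsum M N i) => [i x y|i j ij x].
    by apply/pair_equal_spec; rewrite /= subr0.
  by rewrite /= raddf0.
by move=> i j k e a x; rewrite /= act0.
Defined.

Definition dsum_fst : dghom (dsum M N) M.
Proof.
unshelve eexists; first by exists (fun i (x : dsum M N i) => x.1).
by [].
Defined.

Definition dsum_pair (f : dghom X M) (g : dghom X N) : dghom X (dsum M N).
Proof.
unshelve eexists.
  exists (fun i (x : X i) => (f i x, g i x) : dsum M N i) => [i x y|i j ij x].
    by rewrite /= !cmB.
  by rewrite /= !cm_d.
by move=> i j k e a x; rewrite /= !dh_act.
Defined.
End DsumMaps.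

Definition dghom_opp M N (f : dghom M N) : dghom M N.
Proof.
unshelve eexists.
  exists (fun i (x : M i) => - f i x) => [i x y|i j ij x].
    by rewrite cmB opprD.
  by rewrite cm_d raddfN.
by move=> i j k e a x; rewrite /= dh_act actN.
Defined.

(* The homotopy pushout of N <- M -> M' is the cone of (w, f); its square     *)
(* commutes up to homotopy once the map from M' is given the opposite sign.   *)
Section HomotopyPushout.
Variables (M M' N : dgmod A) (w : dghom M M') (f : dghom M N).

Definition hpush := cone (dsum_pair w f).

Definition hpush_l : dghom M' hpush :=
  dghom_comp (cone_in (dsum_pair w f))
    (dghom_comp (dsum_inl M' N) (dghom_opp (dghom_id M'))).

Definition hpush_r : dghom N hpush :=
  dghom_comp (cone_in (dsum_pair w f)) (dsum_inr M' N).

(** The homotopy is the [M] coordinate of the cone: the boundary of (x, 0) has second part (w x, f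
    x). *)
Lemma hpush_sq i (x : M i) : cocyc x ->
  bdry (hpush_r i (f i x) - hpush_l i (w i x)).
Proof.
elim/succ_ind: i x => h x xZ.
have := cone_bdryI (dsum_pair w f) x (0 : dsum M' N h).
rewrite xZ oppr0 raddf0 addr0; congr bdry; do ![apply/pair_equal_spec; split];
  by rewrite /= ?oppr0 ?addr0 ?subr0 ?add0r ?opprK.
Qed.

(** The comparison of cones induced by the square of [hpush_sq]. As the square commutes only up to
    homotopy, the extra coordinate [x.1] in the middle carries that homotopy. *)
Definition cone_hpush : dghom (cone f) (cone hpush_l).
Proof.
unshelve eexists.
  exists (fun i (x : cone f i) =>
    (w _ x.1, (x.1, (0, x.2))) : cone hpush_l i) => [i x y|i j ij x].
    by do ![apply/pair_equal_spec; split]; rewrite /= ?cmB ?subr0.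
  case: _ / ij; do ![apply/pair_equal_spec; split].
  - by rewrite /= raddfMz /= cm_d.
  - by rewrite /= add0r.
  - by rewrite /= raddf0 addr0 addNr.
  - by rewrite /= add0r.
move=> i j k e a x; do ![apply/pair_equal_spec; split] => //.
- by rewrite /= raddfMz /= dh_act.
- by rewrite /= act0.
Defined.
End HomotopyPushout.

Lemma pairMz (U V : zmodType) (x : (U * V)%type) (n : int) :
  x *~ n = (x.1 *~ n, x.2 *~ n).
Proof.
by rewrite [LHS]surjective_pairing (raddfMz (@fst U V)) (raddfMz (@snd U V)).
Qed.

Section DsumCone.
Variables (M N Y Y' : dgmod A) (f : dghom (dsum M N) Y).
Variable r : dghom (cone (dghom_comp f (dsum_inl M N))) Y'.

Definition dsum_rest : dghom N Y' :=
  dghom_comp r (dghom_comp (cone_in _) (dghom_comp f (dsum_inr M N))).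

(** Treats a map out of a direct sum one summand at a time: once the part on [M] is disposed of by
    [r], what remains is [dsum_rest] on [N]. *)
Definition cone_dsum : dghom (cone f) (cone dsum_rest).
Proof.
unshelve eexists.
  exists (fun i (x : cone f i) =>
    (x.1.2, r _ (x.1.1, x.2)) : cone dsum_rest i) => [i x y|i j ij x].
    by apply/pair_equal_spec; rewrite /= -cmB.
  case: _ / ij; apply/pair_equal_spec; split=> //.
  rewrite /= -cm_d -raddfD /=; congr (r _ _); apply/pair_equal_spec.
  rewrite /= add0r addrA -raddfD /=; split=> //; congr (f _ _ + _).
  by rewrite [LHS]surjective_pairing; congr pair; rewrite /= ?addr0 ?add0r.
move=> i j k e a x; apply/pair_equal_spec; split; first by rewrite /= pairMz.
by rewrite [RHS]/= -(dh_act r) /= pairMz.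
Defined.
End DsumCone.

Section RegularCone.
Variables (Y : dgmod A) (f : dghom (regular_mod A) Y) (t : A 0) (y : Y (0 - 1)).
Hypothesis ty : sc t (f 0 (dgr1 A)) = cd (subrK 1 0) y.

Lemma regular_cone_eq (i : int) : i + 1 + (0 - 1) = i.
Proof. by rewrite addrA addr0 addrK. Qed.

(** Since f a = a (f 1) and t (f 1) = d y, the map t f is null-homotopic through a |-> a y up to
    sign; the homotopy extends multiplication by [t] on [Y] to the cone of [f]. *)
Definition regular_cone : dghom (cone f) Y.
Proof.
unshelve eexists.
  exists (fun i (x : cone f i) =>
    sc t x.2 - act (regular_cone_eq i) (x.1 : A (i + 1)) y *~ (-1) ^ i).
    move=> i x x' /=; rewrite scB actBl mulrzBl opprD opprK addrACA.
    by rewrite opprB [_ + act _ _ _ *~ _]addrC.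
  move=> i j ij x; case: _ / ij.
  rewrite raddfB /= sc_cd cdMz.
  have e1 : i + 1 + 1 + (0 - 1) = i + 1 by rewrite addrA addr0 addrK.
  have fx : f _ x.1 = act (addr0 (i + 1)) (x.1 : A (i + 1)) (f 0 (dgr1 A)).
    by rewrite -dh_act /= dgrM1r.
  rewrite (act_d _ erefl (subrK 1 0) erefl e1 (addr0 (i + 1))) -ty -sc_act -fx.
  rewrite actMzl (eq_irrelevance (regular_cone_eq _) e1).
  rewrite (eq_irrelevance (shift_d_eq 1 erefl) (erefl (i + 1 + 1))).
  rewrite mulrzDl -!mulrzA [(-1) ^ (i + 1)]sgnM mulrC -mulrA sgn_sq mulr1.
  rewrite mulrAC sgn_sq mul1r !expr1z mulrN1z scD opprD opprK.
  by rewrite [sc t (f _ _) + _]addrC -addrA [- _ + _]addrC.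
move=> i j k e s x; rewrite /= actBr actMz -sc_act; congr (_ - _).
rewrite actMzl -!mulrzA -(actA (shift_act_eq 1 e) (regular_cone_eq k)
  (regular_cone_eq j) e).
rewrite mul1r; congr (_ *~ _); rewrite -e sgnM mulrA.
by rewrite sgn_sq mul1r.
Defined.
End RegularCone.
End ConeMaps.

(** * Moving a shift from the source of a map to its target *)

Section ShiftCancel.
Variable A : cdgring.
Implicit Types M N Y : dgmod A.

Variables (a b : int) (ab : a + b = 0).

Lemma shift_cancel_eq (i : int) : i = i + a + b.
Proof. by rewrite -addrA ab addr0. Qed.

Lemma shift_cancel_eq' (i : int) : i = i + b + a.
Proof. by rewrite -addrA [b + a]addrC ab addr0. Qed.

Definition shift_cancel M : dghom M (shift a (shift b M)).
Proof.
unshelve eexists.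
  exists (fun i (x : M i) =>
    ecast k (M k) (shift_cancel_eq i) x : shift a (shift b M) i).
  - by move=> i x y; apply: (ecastB (C := M)).
  - move=> i j ij x; rewrite /= -mulrzA -sgnM [b + a]addrC ab expr0z mulr1z.
    by rewrite (cd_ecast ij _ _ (shift_cancel_eq j)).
move=> i j k e s x; rewrite /= -mulrzA -sgnM -mulrDl [b + a]addrC ab mul0r expr0z mulr1z.
exact: ecast_act.
Defined.

Section ConeShift.
Variables (M Y : dgmod A) (f : dghom (shift b M) Y).

Definition unshift_hom : dghom M (shift a Y) :=
  dghom_comp (shift_hom a f) (shift_cancel M).

(** The shift multiplies the whole cone differential by (-1)^b, including its component from [M] to
    [Y]; the sign on the first coordinate undoes this. *)
Definition cone_shift : dghom (cone f) (shift b (cone unshift_hom)).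
Proof.
unshelve eexists.
  exists (fun i (x : cone f i) =>
    (ecast k (M k) (addrAC i 1 b) x.1 *~ (-1) ^ b,
     ecast k (Y k) (shift_cancel_eq' i) x.2) : shift b (cone unshift_hom) i).
  - move=> i x y; apply/pair_equal_spec; split; last exact: (ecastB (C := Y)).
    by rewrite /= (ecastB (C := M)) mulrzBl.
  - move=> i j ij x; case: _ / ij; rewrite [RHS]/= pairMz; apply/pair_equal_spec; split.
      rewrite /= cdMz !(ecastMz (C := M)).
      rewrite (cd_ecast (C := M) (shift_d_eq b (shift_d_eq 1 erefl)) _ _
        (addrAC (i + 1) 1 b)).
      by rewrite -!mulrzA; congr (_ *~ _); rewrite mulrC mulrA.
    have e : i + 1 = i + b + 1 + a by rewrite [i + b + 1]addrAC -shift_cancel_eq'.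
    rewrite /= !(ecastMz (C := M)).
    rewrite (ecast_ecast (C := M) _ _ (congr1 (+%R^~ b) e)) (ecast_shift e).
    rewrite [f _ (_ *~ _)](@cmMz _ _ f).
    have fe : f _ (ecast k (M (k + b)) e x.1) = ecast k (Y k) e (f _ x.1).
      exact: (cm_ecast (C := shift b M)).
    rewrite fe -(ecast_shift _ (congr1 (+%R^~ a) (shift_d_eq b (erefl (i + 1))))).
    rewrite (ecastMz (C := Y)).
    rewrite (ecast_ecast (C := Y) _ _ (shift_cancel_eq' (i + 1))) mulrzDl.
    rewrite mulrz_sgnK -mulrzA -sgnM ab expr0z mulr1z.
    rewrite (cd_ecast (C := Y) erefl _ _ (shift_cancel_eq' (i + 1))).
    by move: (shift_cancel_eq' (i + 1)) => e1; case: _ / e1.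
  move=> i j k e s x; rewrite [RHS]/= pairMz; apply/pair_equal_spec; split.
    rewrite /= !(ecastMz (C := M)) actMz (ecast_act _ (addrAC j 1 b) _
      (shift_act_eq 1 (shift_act_eq b e))).
    by rewrite -!mulrzA; rewrite -!sgnM; congr (_ *~ (_ ^ _)); ring.
  rewrite /= -mulrzA -sgnM -mulrDl ab mul0r expr0z mulr1z.
  exact: ecast_act.
Defined.
End ConeShift.
End ShiftCancel.

(** * Finite powers of a DG module *)

Section Powers.
Variable A : cdgring.
Implicit Types M : dgmod A.

Definition pow_cx (b : nat) (C : complex) : complex.
Proof.
exists (fun i => {ffun 'I_b -> C i} : zmodType)
  (fun i j ij (x : {ffun 'I_b -> C i}) => [ffun l => cd ij (x l)]).
- by move=> i j ij x y; apply/ffunP => l; rewrite !ffunE cdB.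
- by move=> i j k ij jk x; apply/ffunP => l; rewrite !ffunE cdd.
Defined.

Lemma ffunMz (I : finType) (V : zmodType) (x : {ffun I -> V}) (n : int) l :
  (x *~ n) l = x l *~ n.
Proof.
case: n => n; rewrite ?NegzE ?mulrNz -!pmulrn.
  by elim: n => [|n IHn]; rewrite ?mulr0n ?ffunE // !mulrS ffunE IHn.
by rewrite ffunE; congr (- _); elim: n.+1 => [|p IHp]; rewrite ?mulr0n ?ffunE //
  !mulrS ffunE IHp.
Qed.

Definition pow (b : nat) M : dgmod A.
Proof.
exists (pow_cx b M)
  (fun i j k e a (x : {ffun 'I_b -> M j}) => [ffun l => act e a (x l)]).
- by move=> i j k e m x y; apply/ffunP => l; rewrite !ffunE actBl.
- by move=> i j k e m x y; apply/ffunP => l; rewrite !ffunE actBr.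
- move=> i j k ij jk p e1 e2 e3 e4 s t m; apply/ffunP => l; rewrite !ffunE.
  exact: actA.
- by move=> i e x; apply/ffunP => l; rewrite !ffunE act1.
- move=> i j k i' j' p e ei ej ek e1 e2 a x; apply/ffunP => l.
  by rewrite !ffunE ffunMz !ffunE (act_d e ei ej ek e1 e2).
Defined.

Definition pow_proj b M (l : 'I_b) : dghom (pow b M) M.
Proof.
unshelve eexists.
  exists (fun i (x : pow b M i) => (x : {ffun 'I_b -> M i}) l) => [i x y|i j ij x].
    by rewrite !ffunE.
  by rewrite ffunE.
by move=> i j k e a x; rewrite /= ffunE.
Defined.

Definition pow_join b M : dghom (dsum M (pow b M)) (pow b.+1 M).
Proof.
unshelve eexists.
  exists (fun i (x : dsum M (pow b M) i) =>
    [ffun l => oapp (x.2 : {ffun 'I_b -> M i}) x.1 (unlift ord0 l)] : pow b.+1 M i)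
    => [i x y|i j ij x]; apply/ffunP => l; rewrite !ffunE;
    by case: unliftP => [k|] _ /=; rewrite ?ffunE.
move=> i j k e a x; apply/ffunP => l; rewrite !ffunE.
by case: unliftP => [p|] _ /=; rewrite ?ffunE.
Defined.

Lemma pow_join_bij b M i : bijective (pow_join b M i).
Proof.
exists (fun x : pow b.+1 M i => let y := x : {ffun 'I_b.+1 -> M i} in
   (y ord0, [ffun k => y (lift ord0 k)]) : dsum M (pow b M) i).
  move=> [x y]; apply/pair_equal_spec; rewrite !ffunE unlift_none; split=> //.
  by apply/ffunP => k; rewrite !ffunE liftK.
move=> x; apply/ffunP => l; rewrite !ffunE.
by case: unliftP => [k|] -> /=; rewrite ?ffunE.
Qed.
End Powers.

(** * Local quasi-isomorphisms and vanishing of extensions *)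

Section LocalEquivalences.
Variables (A : cdgring) (S : A 0 -> Prop).
Hypothesis S1 : S (dgr1 A).
Hypothesis SM : forall s t, S s -> S t -> S (mul0 s t).
Implicit Types M N X Y : dgmod A.

(** For a cocycle: its class vanishes in the localization of the cohomology at [S]. *)
Definition tors M i (x : M i) : Prop := exists2 t, S t & bdry (sc t x).

Lemma bdry_tors M i (x : M i) : bdry x -> tors x.
Proof. by move=> xB; exists (dgr1 A); rewrite ?sc1. Qed.

Lemma torsB M i (x y : M i) : tors x -> tors y -> tors (x - y).
Proof.
move=> [s Ss xB] [t St yB]; exists (mul0 s t); first exact: SM.
by rewrite scB; apply: bdryB; [rewrite mul0C|]; rewrite scM; apply: sc_bdry.
Qed.

Lemma torsN M i (x : M i) : tors x -> tors (- x).
Proof. by move=> xB; rewrite -sub0r; apply: torsB => //; apply/bdry_tors/bdry0. Qed.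

Lemma torsD M i (x y : M i) : tors x -> tors y -> tors (x + y).
Proof. by rewrite -{2}(opprK y) => xZ /torsN; apply: torsB. Qed.

Lemma tors_cong M i (x y : M i) : tors (x - y) -> tors y -> tors x.
Proof. by move=> xy /(torsD xy); rewrite subrK. Qed.

Lemma tors_sc M i t (x : M i) : tors x -> tors (sc t x).
Proof. by case=> s Ss xB; exists s; rewrite // scC; apply: sc_bdry. Qed.

Lemma tors_scE M i t (x : M i) : S t -> tors (sc t x) -> tors x.
Proof. by move=> St [s Ss xB]; exists (mul0 s t); rewrite ?scM //; apply: SM. Qed.

Lemma tors_hom M N (f : dghom M N) i (x : M i) : tors x -> tors (f i x).
Proof. by case=> s Ss xB; exists s => //; rewrite -dh_sc; apply: chmap_bdry. Qed.

Lemma tors_act M i j k (e : i + j = k) (a : A i) (x : M j) :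
  cocyc a -> tors x -> tors (act e a x).
Proof.
by move=> aZ [s Ss xB]; exists s; rewrite // sc_act; apply: act_bdryr.
Qed.

(** Injectivity and surjectivity of the map induced on cohomology localized at [S]. *)
Definition local_qiso M N (f : dghom M N) : Prop :=
  (forall i (x : M i), cocyc x -> tors (f i x) -> tors x) /\
  (forall i (y : N i), cocyc y ->
     exists t x, [/\ S t, cocyc x & tors (f i x - sc t y)]).

Definition local_acyclic M : Prop := forall i (x : M i), cocyc x -> tors x.

Definition local_trunc (m : int) M : Prop :=
  forall i (x : M i), m <= i -> cocyc x -> tors x.

Lemma local_qiso_ext M N (f g : dghom M N) :
  (forall i x, f i x = g i x) -> local_qiso f -> local_qiso g.
Proof.
move=> fg [inj sur]; split=> [i x|i y yZ]; first by rewrite -fg; apply: inj.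
by have [t [x [St xZ xy]]] := sur i y yZ; exists t, x; rewrite -fg.
Qed.

Lemma local_qiso_comp M N X (g : dghom N X) (f : dghom M N) :
  local_qiso f -> local_qiso g -> local_qiso (dghom_comp g f).
Proof.
move=> [fi fs] [gi gs]; split=> [i x xZ /= gfx|i y yZ].
  by apply: fi => //; apply: gi gfx; apply: chmap_cocyc.
have [t [x [St xZ xy]]] := gs i y yZ.
have [s [x' [Ss x'Z xx']]] := fs i x xZ.
exists (mul0 s t), x'; split=> //; first exact: SM.
have -> : (dghom_comp g f) i x' - sc (mul0 s t) y =
    g i (f i x' - sc s x) + sc s (g i x - sc t y).
  by rewrite raddfB /= dh_sc scB scM addrA subrK.
by apply: torsD; [apply: tors_hom|apply: tors_sc].
Qed.

Lemma local_trunc_qiso m M N (f : dghom M N) :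
  local_qiso f -> local_trunc m M -> local_trunc m N.
Proof.
move=> [_ fs] tM i y mi yZ; have [t [x [St xZ xy]]] := fs i y yZ.
apply: (tors_scE St); rewrite -(opprK (sc t y)) -(subKr (f i x) (sc t y)) opprK.
by apply: torsB xy; apply: tors_hom; apply: tM.
Qed.

Lemma quasi_iso_local_qiso M N (f : dghom M N) : quasi_iso f -> local_qiso f.
Proof.
move=> /quasi_isoP qf; split=> [i x xZ [t St fB]|i y yZ].
  have [inj _] := qf _ _ _ (subrK 1 i) (erefl (i + 1)).
  exists t => //; apply: inj; first exact: (cocycE _ (sc_cocyc t xZ)).
  by case: fB => y yE; exists y; rewrite -yE dh_sc.
have [_ sur] := qf _ _ _ (subrK 1 i) (erefl (i + 1)).
have [x xZ [z zE]] := sur y yZ; exists (dgr1 A), x; split=> //.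
by apply: bdry_tors; rewrite sc1 zE; apply: bdryI.
Qed.

(** A cocycle (m, n) has f m = - d n, so local injectivity removes m; local surjectivity then writes
    the remaining class of [N] as an image from [M], and such images die in the cone. *)
Lemma local_acyclic_cone M N (f : dghom M N) : local_qiso f -> local_acyclic (cone f).
Proof.
move=> [inj sur]; elim/succ_ind => h [m n] /cone_cocyc[mZ mn].
have [t St /(bdryE erefl)[m' mE]] : tors (m : M _).
  apply: inj => //; apply: bdry_tors.
  by rewrite (canRL (addrK _) mn) sub0r; apply/bdryN/bdryI.
pose n' : N (h + 1) := sc t n + f _ m'.
have n'Z : cocyc n'.
  rewrite /cocyc /n' raddfD /= sc_cd -cm_d -mE dh_sc -scD [_ + f _ m]addrC mn.
  exact: sc0.
have [s [x [Ss xZ xn']]] := sur _ n' n'Z.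
apply: (tors_scE (SM Ss St)); rewrite scM.
have -> : sc s (sc t ((m, n) : cone f (h + 1))) =
  cone_in f _ (sc s n' - f _ x) + ((0, f _ x) : cone f (h + 1))
    - sc s ((- cd erefl m', f _ m' + cd erefl 0) : cone f (h + 1)).
  rewrite !sc_cone; apply/pair_equal_spec; split; rewrite /=.
    by rewrite mE scN opprK !add0r.
  by rewrite raddf0 addr0 subrK /n' scD addrK.
apply: torsB; last by apply/bdry_tors/sc_bdry/cone_bdryI.
apply: torsD; first by apply: tors_hom; rewrite -opprB; apply: torsN.
apply: bdry_tors; have := cone_bdryI f x 0; congr bdry; apply/pair_equal_spec.
by rewrite xZ oppr0 raddf0 addr0.
Qed.

Lemma local_qiso_cone_in_acyclic M N (f : dghom M N) :
  local_acyclic M -> local_qiso (cone_in f).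
Proof.
move=> aM; split; elim/succ_ind => h.
  move=> n nZ [t St]; rewrite /= sc_cone sc0 => /cone_bdryE[m [n' [m0 tn]]].
  have [|s Ss sm] := aM _ m.
    by rewrite /cocyc -(opprK (cd _ m)) -m0 oppr0.
  apply: (tors_scE St); exists s => //.
  rewrite tn scD -dh_sc -sc_cd; apply: bdryD; last exact: bdryI.
  exact: chmap_bdry.
move=> [m n] /cone_cocyc[mZ mn].
have [t St /(bdryE erefl)[m' mE]] := aM _ (m : M _) mZ.
exists t, (sc t n + f _ m'); split=> //.
  by rewrite /cocyc raddfD /= sc_cd -cm_d -mE dh_sc -scD [_ + f _ m]addrC mn sc0.
apply: bdry_tors; have := cone_bdryI f m' 0; congr bdry; rewrite sc_cone.
by apply/pair_equal_spec; rewrite /= raddf0 addr0 sub0r mE [sc t n + _]addrC addrK.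
Qed.

(** The quotient of the pushout by [N] is, up to sign, the cone of [w], which is locally acyclic.
    The proof does this on elements, clearing the [M] and [M'] coordinates with the two halves of
    [local_qiso w]. *)
Lemma local_qiso_hpush_r M M' N (w : dghom M M') (f : dghom M N) :
  local_qiso w -> local_qiso (hpush_r w f).
Proof.
move=> [wi ws]; split; elim/succ_ind => h.
  move=> n nZ [t St]; rewrite /= sc_cone sc0 sc_dsum.
  case/(cone_bdryE (f := dsum_pair w f)) => m [[m' n'] [m0 mn]].
  have /= wm := congr1 fst mn; have /= {mn}tn := congr1 snd mn.
  have mZ : cocyc m by rewrite /cocyc -(opprK (cd _ m)) -m0 oppr0.
  have [|s Ss sm] := wi _ m mZ.
    apply: bdry_tors; move: wm; rewrite /= sc0 => /esym/eqP.
    by rewrite addr_eq0 => /eqP ->; apply/bdryN/bdryI.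
  apply: (tors_scE St); exists s => //; move: tn => /= ->.
  rewrite scD -dh_sc -sc_cd; apply: bdryD; last exact: bdryI.
  exact: chmap_bdry.
move=> [m [m' n]] /(@cone_cocyc _ _ _ (dsum_pair w f))[mZ mn].
have /= wm := congr1 fst mn; have /= {mn}fm := congr1 snd mn.
have [|t St /(bdryE erefl)[m0 mE]] := wi _ (m : M _) mZ.
  apply: bdry_tors; rewrite -[w _ _](addrK (cd erefl m')) wm sub0r.
  exact/bdryN/bdryI.
pose m1 : M' (h + 1) := sc t m' + w _ m0.
have m1Z : cocyc m1.
  by rewrite /cocyc /m1 raddfD /= sc_cd -cm_d -mE dh_sc -scD [_ + w _ m]addrC wm sc0.
have [s [x [Ss xZ xm1]]] := ws _ m1 m1Z.
exists (mul0 s t), (sc s (sc t n + f _ m0) - f _ x); split; first exact: SM.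
  rewrite /cocyc raddfB /= -cm_d xZ raddf0 subr0 sc_cd raddfD /= sc_cd -cm_d -mE.
  by rewrite dh_sc -scD [_ + f _ m]addrC fm !sc0.
have -> : hpush_r w f _ (sc s (sc t n + f _ m0) - f _ x)
    - sc (mul0 s t) ((m, (m', n)) : hpush w f (h + 1)) =
  sc s ((- cd erefl m0, dsum_pair w f _ m0 + cd erefl 0) : hpush w f (h + 1))
  - ((- cd erefl x, dsum_pair w f _ x + cd erefl 0) : hpush w f (h + 1))
  + dghom_comp (cone_in _) (dsum_inl M' N) _ (w _ x - sc s m1).
  rewrite scM !(raddf0, addr0) !sc_cone !sc_dsum.
  do ![apply/pair_equal_spec; split] => /=.
  - by rewrite mE xZ sub0r scN oppr0 subr0 addr0.
  - by rewrite sub0r /m1 !scD opprD addrA subrK addrCA subrr addr0.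
  - by rewrite !scD addr0 [LHS]addrAC [sc s (sc t n) + _]addrC addrK.
apply: torsD; last by apply: tors_hom.
by apply: torsB; apply: bdry_tors; [apply: sc_bdry|]; apply: cone_bdryI.
Qed.

(* Locally, Hom(M, Y) = 0 in D(A) whenever H^q(Y) = 0 for q >= m: a morphism  *)
(* f : M -> Y is zero iff Y -> cone f is a split monomorphism.                *)
Definition ext_vanish (m : int) M : Prop :=
  forall Y, local_trunc m Y -> forall f : dghom M Y,
  exists Y' (r : dghom (cone f) Y'), local_qiso (dghom_comp r (cone_in f)).

Lemma ext_vanish_le m m' M : m' <= m -> ext_vanish m M -> ext_vanish m' M.
Proof.
by move=> mm' vM Y tY; apply: vM => i x mi; apply: tY; apply: le_trans mi.
Qed.

(** A map from [M] is extended to the sum by the projection, and the retraction obtained there is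
    restricted to the cone of the original map. *)
Lemma ext_vanish_summand m M N : ext_vanish m (dsum M N) -> ext_vanish m M.
Proof.
move=> vMN Y tY f; have [Y' [r rq]] := vMN Y tY (dghom_comp f (dsum_fst M N)).
pose u : dghom (cone f) (cone (dghom_comp f (dsum_fst M N))) :=
  @cone_map _ _ _ _ _ f (dghom_comp f (dsum_fst M N)) (dsum_inl M N) (dghom_id Y)
    (fun=> fun=> erefl).
exists Y', (dghom_comp r u); apply: local_qiso_ext rq => i x.
by rewrite /=.
Qed.

(** Killing [f] after [w] leaves an obstruction defined on the cone of [w]; that cone is locally
    acyclic, so coning it off changes [Y'] only by a local isomorphism. *)
Lemma ext_vanish_target m M M' (w : dghom M M') :
  local_qiso w -> ext_vanish m M -> ext_vanish m M'.
Proof.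
move=> wq vM Y tY f; have [Y' [r rq]] := vM Y tY (dghom_comp f w).
pose g : dghom (cone w) Y' := dghom_comp r
  (@cone_map _ _ _ _ _ w (dghom_comp f w) (dghom_id M) f (fun=> fun=> erefl)).
pose u : dghom (cone f) (cone g) := @cone_map _ _ _ _ _ f g (cone_in w)
  (dghom_comp r (cone_in (dghom_comp f w))) (fun=> fun=> erefl).
exists (cone g), u.
apply: (local_qiso_ext (f := dghom_comp (cone_in g)
   (dghom_comp r (cone_in (dghom_comp f w))))) => [//|].
by apply: local_qiso_comp rq _; apply/local_qiso_cone_in_acyclic/local_acyclic_cone.
Qed.

(** A map from [M] need not extend along [w], but after replacing [Y] by the homotopy pushout it
    does so up to homotopy. *)
Lemma ext_vanish_source m M M' (w : dghom M M') :
  local_qiso w -> ext_vanish m M' -> ext_vanish m M.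
Proof.
move=> wq vM' Y tY f; have jq := local_qiso_hpush_r f wq.
have [Y' [r rq]] := vM' _ (local_trunc_qiso jq tY) (hpush_l w f).
exists Y', (dghom_comp r (cone_hpush w f)).
by apply: local_qiso_ext (local_qiso_comp jq rq) => i x; rewrite /= raddf0.
Qed.

(** Rotation of the triangle: the cone of [N -> cone f] is [shift 1 M]. *)
Lemma local_qiso_cone_factor M N (f : dghom M N) :
  local_qiso (@cone_factor _ _ _ _ (cone_in f) (cone_out f) (fun=> fun=> erefl)).
Proof.
split; elim/succ_ind => h.
  move=> [n [p n']] /(@cone_cocyc _ _ _ (cone_in f))[nZ eq].
  have /= {eq}nE := congr1 snd eq => -[t St]; rewrite /= sc_shift.
  case/(@bdry_shift _ 1 M)/(bdryE erefl) => p' pE; exists t => //.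
  have := cone_bdryI (cone_in f) (sc t n' + f _ p') ((- p', 0) : cone f h).
  congr bdry; rewrite 2!sc_cone; do ![apply/pair_equal_spec; split].
  - rewrite raddfD /= sc_cd -cm_d -pE dh_sc -scD -scN [_ + f _ p]addrC.
    by congr sc; apply/esym/eqP; rewrite -addr_eq0 nE.
  - rewrite /= add0r expr1z mulrN1z raddfN /= opprK pE.
    by congr (cd _ p'); apply: eq_irrelevance.
  - by rewrite /= raddf0 addr0 raddfN /= addrK.
move=> p pZ; exists (dgr1 A), ((- f _ p, (p, 0)) : cone (cone_in f) (h + 1)).
split=> //; last by apply: bdry_tors; rewrite sc1 subrr; apply: bdry0.
have pZ' := (@cocyc_shift _ 1 M _ p).1 pZ.
apply/(@cone_cocyc _ _ _ (cone_in f)); split; first exact/cocycN/chmap_cocyc.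
apply/pair_equal_spec; split; first by rewrite /= add0r; apply: pZ.
by rewrite /= raddf0 addr0 addNr.
Qed.

(* The morphism f on cone u is first killed on N, by passing to Y'; it then   *)
(* factors through the cone of N -> cone u, that is through shift 1 M.        *)
Lemma ext_vanish_cone m M N (u : dghom M N) :
  ext_vanish m (shift 1 M) -> ext_vanish m N -> ext_vanish m (cone u).
Proof.
move=> vM vN Y tY f; have [Y' [r rq]] := vN Y tY (dghom_comp f (cone_in u)).
pose f1 : dghom (cone (cone_in u)) Y' := dghom_comp r
  (@cone_map _ _ _ _ _ (cone_in u) (dghom_comp f (cone_in u)) (dghom_id N) f
    (fun=> fun=> erefl)).
have tY' := local_trunc_qiso rq tY.
have [Y2 [r1 r1q]] := ext_vanish_source (local_qiso_cone_factor u) vM tY' f1.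
pose v : dghom (cone f) (cone f1) := @cone_map _ _ _ _ _ f f1 (cone_in (cone_in u))
  (dghom_comp r (cone_in (dghom_comp f (cone_in u)))) (fun=> fun=> erefl).
exists Y2, (dghom_comp r1 v).
by apply: local_qiso_ext (local_qiso_comp rq r1q) => i x.
Qed.

Lemma ext_vanish_dsum m M N :
  ext_vanish m M -> ext_vanish m N -> ext_vanish m (dsum M N).
Proof.
move=> vM vN Y tY f; have [Y' [r rq]] := vM Y tY (dghom_comp f (dsum_inl M N)).
have [Y2 [r1 r1q]] := vN Y' (local_trunc_qiso rq tY) (dsum_rest r).
exists Y2, (dghom_comp r1 (cone_dsum r)).
by apply: local_qiso_ext (local_qiso_comp rq r1q) => i x.
Qed.

Lemma tors_shift n M i (x : shift n M i) : tors x <-> tors (x : M (i + n)).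
Proof.
split=> -[t St xB]; exists t => //.
  by move/bdry_shift: xB; rewrite sc_shift.
by apply/bdry_shift; rewrite sc_shift.
Qed.

Lemma local_qiso_shift n M N (f : dghom M N) : local_qiso f -> local_qiso (shift_hom n f).
Proof.
move=> [inj sur]; split=> [i x /cocyc_shift xZ /tors_shift fx|i y /cocyc_shift yZ].
  by apply/tors_shift; apply: inj.
have [t [x [St xZ xy]]] := sur _ _ yZ.
exists t, (x : shift n M i); split=> //; first exact/cocyc_shift.
by apply/tors_shift; rewrite sc_shift.
Qed.

Lemma local_qiso_bij M N (f : dghom M N) : (forall i, bijective (f i)) -> local_qiso f.
Proof.
move=> fb; split=> [i x xZ [t St /= [y]]|i y yZ].
  have [g fK gK] := fb i; have [g' f'K g'K] := fb (i - 1).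
  rewrite -dh_sc -[y]g'K -cm_d => /(can_inj fK) tx.
  by exists t; rewrite // tx; apply: bdryI.
have [g fK gK] := fb i; have [g' f'K g'K] := fb (i + 1).
exists (dgr1 A), (g y); split=> //; last first.
  by apply: bdry_tors; rewrite sc1 gK subrr; apply: bdry0.
by rewrite /cocyc -[cd _ _]f'K cm_d gK yZ -{1}(raddf0 (f (i + 1))) f'K.
Qed.

Lemma ext_vanish_shift m n M : ext_vanish m M -> ext_vanish (m - n) (shift n M).
Proof.
move=> vM Y tY f; have e : - n + n = 0 by rewrite addNr.
have [|Y' [r rq]] := vM (shift (- n) Y) _ (unshift_hom e f).
  move=> i x mi xZ; apply/tors_shift; apply: tY; first by rewrite lerB.
  exact/cocyc_shift.
have e' : n - n = 0 by rewrite subrr.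
exists (shift n Y'), (dghom_comp (shift_hom n r) (cone_shift e f)).
have sq : local_qiso (shift_cancel e' Y).
  apply: local_qiso_bij => i; move: (shift_cancel_eq e' i) => ei.
  exists (fun y : Y (i + n - n) => ecast k (Y k) (esym ei) y) => x /=;
  rewrite (ecast_ecast (C := Y) _ _ erefl) //.
apply: local_qiso_ext (local_qiso_comp sq (local_qiso_shift n rq)) => i x /=.
congr (r _ (_, _)); last by congr (ecast k (Y k) _ x); apply: eq_irrelevance.
by rewrite (@ecast0 M) mul0rz.
Qed.

Lemma local_qiso_scalar M (t : A 0) (f : dghom M M) :
  S t -> (forall i x, f i x = sc t x) -> local_qiso f.
Proof.
move=> St fE; split=> [i x _|i y yZ]; first by rewrite fE => /(tors_scE St).
exists t, y; split=> //; rewrite fE subrr.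
exact/bdry_tors/bdry0.
Qed.

(** A map from [A] is determined by the image of 1, a class of degree 0 in [Y], which is torsion by
    assumption; [regular_cone] then extends multiplication by some [t] in [S], a local
    isomorphism. *)
Lemma ext_vanish_regular : ext_vanish 0 (regular_mod A).
Proof.
move=> Y tY f; have [|t St [y yE]] := tY 0 (f 0 (dgr1 A)) (lexx 0).
  by apply: chmap_cocyc; apply: (@cocyc_deg0 A).
exists Y, (regular_cone yE); apply: (local_qiso_scalar St) => i x /=.
by rewrite act0l mul0rz subr0.
Qed.

Lemma ext_vanish_pow m M b : ext_vanish m M -> ext_vanish m (pow b M).
Proof.
move=> vM; elim: b => [|b IHb]; last first.
  apply: ext_vanish_target (ext_vanish_dsum vM IHb).
  exact/local_qiso_bij/pow_join_bij.
move=> Y tY f; have f0 i x : dghom_id Y i (f i x) = 0.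
  have -> : x = 0 by apply/ffunP => -[].
  by rewrite /= raddf0.
exists Y, (cone_factor f0); apply: (local_qiso_scalar S1) => i x.
by rewrite sc1.
Qed.
End LocalEquivalences.

(** * Morphisms of the derived category *)

Section DerivedMorphisms.
Variable A : cdgring.
Implicit Types M N W : dgmod A.

Lemma coh_map_id (C : complex) i (u : coh C i) : coh_map (chmap_id C) u = u.
Proof.
have [x ->] := cohE u; rewrite coh_map_class; congr cclass; exact: val_inj.
Qed.

Lemma coh_map_comp (C D E : complex) (g : chmap D E) (f : chmap C D) i
  (u : coh C i) : coh_map (chmap_comp g f) u = coh_map g (coh_map f u).
Proof.
have [x ->] := cohE u; rewrite !coh_map_class; congr cclass; exact: val_inj.
Qed.

Lemma coh_map_ext (C D : complex) (f g : chmap C D) i (u : coh C i) :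
  (forall x, cocyc x -> bdry (f i x - g i x)) -> coh_map f u = coh_map g u.
Proof.
move=> fg; have [x ->] := cohE u; rewrite !coh_map_class; apply/cclass_eq.
exact/fg/cocycleP.
Qed.

Lemma coh_surj M N (f : dghom M N) (qf : quasi_iso f) i (u : coh N i) :
  exists v, coh_map f v = u.
Proof. by have [g _ gK] := qf i; exists (g u). Qed.

Definition coh_inv M N (f : dghom M N) (qf : quasi_iso f) i (u : coh N i) :
  coh M i := projT1 (cid (coh_surj qf u)).

Lemma coh_invK M N (f : dghom M N) (qf : quasi_iso f) i (u : coh N i) :
  coh_map f (coh_inv qf u) = u.
Proof. by rewrite /coh_inv; case: cid. Qed.

Lemma coh_mapK M N (f : dghom M N) (qf : quasi_iso f) i (u : coh M i) :
  coh_inv qf (coh_map f u) = u.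
Proof. by have [g fK _] := qf i; apply: (can_inj fK); rewrite coh_invK. Qed.

(** Cohomology as a functor on formal morphisms; [deq_dact] makes it well defined on D(A). *)
Fixpoint dact M N (u : dmor M N) i : coh M i -> coh N i :=
  match u with
  | dhom _ _ f => @coh_map _ _ f i
  | dinv _ _ _ qf => @coh_inv _ _ _ qf i
  | dcomp _ _ _ v u => dact v (i := i) \o dact u (i := i)
  end.

Lemma deq_dact M N (u v : dmor M N) : deq u v ->
  forall i x, dact u x = dact v x :> coh N i.
Proof.
elim=> {M N u v} //=.
- by move=> M N u v w _ IH _ IH' i x; rewrite IH IH'.
- by move=> L M N v v' u u' _ IH _ IH' i x; rewrite IH IH'.
- by move=> M N u i x; apply: coh_map_id.
- by move=> M N u i x; rewrite coh_map_id.
- move=> M N f g fg i x; apply: coh_map_ext => y _.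
  by rewrite fg subrr; apply: bdry0.
- by move=> L M N g f i x; apply: coh_map_comp.
- by move=> M N f qf i x; rewrite coh_mapK coh_map_id.
- by move=> M N f qf i x; rewrite coh_invK coh_map_id.
Qed.

Lemma d_is_iso_bij M N (u : dmor M N) i : d_is_iso u -> bijective (@dact M N u i).
Proof.
case=> v [vu uv]; exists (@dact _ _ v i) => x.
  by have /= -> := deq_dact vu x; apply: coh_map_id.
by have /= -> := deq_dact uv x; apply: coh_map_id.
Qed.

(** With 1 as the only denominator, local statements become global ones, so results on [local_qiso]
    serve for quasi-isomorphisms too. *)
Lemma local_qiso1_quasi_iso M N (f : dghom M N) :
  local_qiso (fun s => s = dgr1 A) f -> quasi_iso f.
Proof.
move=> [inj sur]; apply/quasi_isoP => h i j hi ij; split=> [x xZ [y fx]|y yZ].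
  have [||t ->] := inj i x; first exact: cocycI xZ.
    by exists (dgr1 A) => //; rewrite sc1 fx; apply: bdryI.
  by rewrite sc1; apply: bdryE.
have [t [x [-> xZ [s ->]]]] := sur i y (cocycI yZ).
rewrite !sc1 => /(bdryE hi) xy; exists x => //; exact: cocycE.
Qed.

Lemma quasi_iso_hpush_r M M' N (w : dghom M M') (f : dghom M N) :
  quasi_iso w -> quasi_iso (hpush_r w f).
Proof.
move=> qw; apply: local_qiso1_quasi_iso; apply: local_qiso_hpush_r => //.
  by move=> s t -> ->; rewrite /mul0 dgrM1l.
exact: quasi_iso_local_qiso.
Qed.

Lemma quasi_iso_comp M N W (g : dghom N W) (f : dghom M N) :
  quasi_iso f -> quasi_iso g -> quasi_iso (dghom_comp g f).
Proof.
move=> qf qg i; have [f' fK f'K] := qf i; have [g' gK g'K] := qg i.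
by exists (f' \o g') => u /=; rewrite coh_map_comp ?gK ?fK // f'K g'K.
Qed.

(** Calculus of fractions, only as far as cohomology sees it: a homotopy pushout merges the roofs of
    two composable morphisms. *)
Lemma dmor_roof M N (u : dmor M N) :
  exists W (f : dghom M W) (s : dghom N W), quasi_iso s /\
    forall i (x : coh M i), coh_map s (dact u x) = coh_map f x.
Proof.
elim: u => {M N} [M N f|M N f qf|L M N v [W1 [f1 [s1 [q1 e1]]]] u [W2 [f2 [s2 [q2 e2]]]]].
- exists N, f, (dghom_id N); split=> [i|i x]; last exact: coh_map_id.
  by exists id => x; apply: coh_map_id.
- exists N, (dghom_id N), f; split=> // i x.
  by rewrite coh_invK -[LHS]coh_map_id.
exists (hpush s2 f1), (dghom_comp (hpush_l s2 f1) f2), (dghom_comp (hpush_r s2 f1) s1).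
split=> [|i x]; first by apply: quasi_iso_comp => //; apply: quasi_iso_hpush_r.
rewrite !coh_map_comp /= e1 -e2 -!coh_map_comp; apply: coh_map_ext => y.
exact: hpush_sq.
Qed.

Lemma d_is_iso_roof M N (u : dmor M N) : d_is_iso u ->
  exists W (f : dghom M W) (s : dghom N W), quasi_iso f /\ quasi_iso s.
Proof.
move=> iu; have [W [f [s [qs e]]]] := dmor_roof u; exists W, f, s; split=> // i.
have [g uK gK] := d_is_iso_bij i iu; have [h sK hK] := qs i.
exists (g \o h) => x /=; first by rewrite -e sK uK.
by rewrite -e gK hK.
Qed.

Section PerfectVanishing.
Variable S : A 0 -> Prop.
Hypothesis S1 : S (dgr1 A).
Hypothesis SM : forall s t, S s -> S t -> S (mul0 s t).

Lemma ext_vanish_iso m M N (u : dmor M N) : d_is_iso u ->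
  ext_vanish S m M <-> ext_vanish S m N.
Proof.
move=> /d_is_iso_roof[W [f [s [qf qs]]]].
move: qf qs => /(quasi_iso_local_qiso S1) qf /(quasi_iso_local_qiso S1) qs.
split=> v.
  by apply: (ext_vanish_source S1 SM qs); apply: (ext_vanish_target S1 SM qf).
by apply: (ext_vanish_source S1 SM qf); apply: (ext_vanish_target S1 SM qs).
Qed.

(** Perfect modules have finite local projective dimension: the property holds for [A] and passes
    through each constructor of [perfect]. *)
Lemma perfect_ext_vanish M : perfect M -> exists m, ext_vanish S m M.
Proof.
elim=> {M} [|n M _ [m vM]|L M N u _ [m vL] _ [m' vM]|M N _ [m vM]|M N [u iu] _ [m vM]].
- by exists 0; apply: ext_vanish_regular.
- by exists (m - n); apply: ext_vanish_shift.
- move=> [v [w [P [Q [f [a [b [c [[ia ib ic] _ _ _]]]]]]]]].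
  have {}vL := (ext_vanish_iso m ia).1 vL.
  have {}vM := (ext_vanish_iso m' ib).1 vM.
  (* The cone is built from the shift of the source, with bound [m - 1], and from the target, with
     bound [m']; lowering a bound weakens [ext_vanish]. *)
  exists (Num.min (m - 1) m'); apply/(ext_vanish_iso _ ic).
  apply: ext_vanish_cone => //; last by apply: ext_vanish_le vM; rewrite ge_min lexx orbT.
  by apply: (ext_vanish_le _ (ext_vanish_shift (n := 1) S1 SM vL)); rewrite ge_min lexx.
- by exists m; apply: ext_vanish_summand vM.
- by exists m; apply/(ext_vanish_iso _ iu).
Qed.
End PerfectVanishing.
End DerivedMorphisms.

(** * Noetherian cohomology *)

Section NoetherianModules.
Variables (R : comPzRingType) (V : lmodType R).
Implicit Types (U W : V -> Prop) (s : seq V).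

Definition submodule U : Prop :=
  [/\ U 0, forall x y, U x -> U y -> U (x - y) & forall a x, U x -> U (a *: x)].

Fixpoint spanned s (x : V) : Prop :=
  if s is v :: s' then exists a, spanned s' (x - a *: v) else x = 0.

Lemma submoduleD U : submodule U -> forall x y, U x -> U y -> U (x + y).
Proof.
move=> [U0 UB _] x y Ux Uy; have -> : x + y = x - (0 - y) by rewrite sub0r opprK.
exact: (UB _ _ Ux (UB _ _ U0 Uy)).
Qed.

Lemma submodule_sum U n (F : 'I_n -> V) : submodule U ->
  (forall l, U (F l)) -> U (\sum_l F l).
Proof.
move=> Us UF; have [U0 _ _] := Us.
by apply: (big_ind U) => // x y; apply: submoduleD.
Qed.

Lemma spanned_submodule s : submodule (spanned s).
Proof.
elim: s => [|v s [s0 sB sZ]] /=; split=> [|x y|a x] //.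
- by move=> -> ->; rewrite subrr.
- by move=> ->; rewrite scaler0.
- by exists 0; rewrite scale0r subr0.
- move=> [a ax] [b by_]; exists (a - b).
  have -> : x - y - (a - b) *: v = (x - a *: v) - (y - b *: v).
    by rewrite scalerBl opprD addrACA -opprD.
  exact: sB.
- by move=> [b bx]; exists (a * b); rewrite -scalerA -scalerBr; apply: sZ.
Qed.

(** Induction on the spanning list. The coefficients at [v] of elements of [U] form an ideal; lifts
    to [U] of its finitely many generators reduce any element of [U] to one spanned by the tail. *)
Lemma noetherian_submodule s U : noetherian R -> submodule U ->
  (forall x, U x -> spanned s x) ->
  exists E : seq V, (forall x, x \in E -> U x) /\
    forall W, submodule W -> (forall x, x \in E -> W x) -> forall x, U x -> W x.
Proof.
move=> noethR; elim: s U => [|v s IHs] U Us sU.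
  by exists [::]; split=> // W [W0 _ _] _ x /sU ->.
have [U0 UB UZ] := Us; have [s0 sB sZ] := spanned_submodule s.
pose I (a : R) := exists2 u, U u & spanned s (u - a *: v).
have Iid : is_ideal I.
  split=> [|a b [u Uu ua] [w Uw wb]|b a [u Uu ua]].
  - by exists 0; rewrite // scale0r subr0.
  - exists (u + w); first exact: submoduleD.
    rewrite scalerDl opprD addrACA.
    exact: submoduleD (spanned_submodule s) _ _ ua wb.
  - by exists (b *: u); [apply: UZ | rewrite -scalerA -scalerBr; apply: sZ].
have [n [g gI]] := noethR I Iid.
have /choice[e eP] (l : 'I_n) : exists u, U u /\ spanned s (u - g l *: v).
  suff [u Uu us] : I (g l) by exists u.
  apply/gI; exists (fun k => (k == l)%:R).
  rewrite (bigD1 l) //= eqxx mul1r big1 ?addr0 // => k /negPf ->.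
  by rewrite mul0r.
have [|E [EU EW]] := IHs (fun x => U x /\ spanned s x) _ (fun x => @proj2 _ _).
  split=> // [x y [Ux sx] [Uy sy]|a x [Ux sx]]; first by split; [apply: UB|apply: sB].
  by split; [apply: UZ|apply: sZ].
exists (E ++ [seq e l | l <- enum 'I_n]); split=> [x|W Ws EsW x Ux].
  rewrite mem_cat => /orP[/EU[]//|/mapP[l _ ->]].
  by have [] := eP l.
have [a ax] := sU x Ux.
have /gI[c aE] : I a by exists x.
have cU : U (\sum_l c l *: e l).
  by apply: submodule_sum => // l; apply: UZ; have [] := eP l.
have cW : W (\sum_l c l *: e l).
  have [_ _ WZ] := Ws; apply: submodule_sum => // l; apply: WZ; apply: EsW.
  by rewrite mem_cat map_f ?orbT // mem_enum.
rewrite -[x](subrK (\sum_l c l *: e l)); apply: submoduleD => //.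
apply: EW => // [y yE|]; first by apply: EsW; rewrite mem_cat yE.
split; first exact: UB.
have -> : x - \sum_l c l *: e l =
    (x - a *: v) - \sum_l c l *: (e l - g l *: v).
  rewrite aE scaler_suml -addrA -opprD -big_split /=; congr (_ - _).
  by apply: eq_bigr => l _; rewrite scalerBr scalerA addrC subrK.
apply: sB => //; apply: submodule_sum; first exact: spanned_submodule.
by move=> l; apply: sZ; have [] := eP l.
Qed.

Lemma fg_spanned : finitely_generated_mod V ->
  exists s, forall x, spanned s x.
Proof.
case=> n [g gP]; exists [seq g l | l <- enum 'I_n] => x.
have [c ->] := gP x; rewrite -big_enum /=.
elim: (enum 'I_n) => [|l s IHs]; first by rewrite big_nil.
by exists (c l); rewrite big_cons addrC addrK.
Qed.

(** Take u with annihilator maximal among those of nonzero elements. If b u is nonzero its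
    annihilator contains, hence equals, that of u; so a b u = 0 forces a u = 0. *)
Lemma associated_prime : noetherian R -> (exists u : V, u <> 0) ->
  exists u : V, u <> 0 /\
    forall a b : R, a *: u <> 0 -> b *: u <> 0 -> (a * b) *: u <> 0.
Proof.
move=> nR [u0 u0N0].
suff [u uN0 umax] : exists2 u : V, u <> 0 & forall w : V, w <> 0 ->
    (forall a : R, a *: u = 0 -> a *: w = 0) -> forall a : R, a *: w = 0 -> a *: u = 0.
  exists u; split=> // a b au bu abu; apply: au; apply: (umax (b *: u) bu) => [c cu|].
    by rewrite scalerA mulrC -scalerA cu scaler0.
  by rewrite scalerA.
apply: contrapT => nomax.
have /choice[f fP] (u : V) : exists w : V, u <> 0 -> [/\ w <> 0,
    forall a : R, a *: u = 0 -> a *: w = 0 & exists2 a : R, a *: w = 0 & a *: u <> 0].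
  apply: contrapT => /forallNP fN; apply: nomax; exists u => [u00|w wN0 uw a aw].
    by apply: (fN 0); rewrite u00.
  apply: contrapT => au; apply: (fN w) => _; split=> //; by exists a.
(* Without a maximal annihilator, iteration gives a strictly increasing chain of annihilators; their
   union is a finitely generated ideal, reached at a finite stage. *)
pose w n := iter n f u0.
have wN0 n : w n <> 0 by elim: n => // n IHn; have [] := fP _ IHn.
have wS n m (a : R) : (n <= m)%N -> a *: w n = 0 -> a *: w m = 0.
  move=> /subnK <-; elim: (m - n)%N => // k IHk /IHk; rewrite addSn.
  by have [_ + _] := fP _ (wN0 (k + n)%N); apply.
have [|n [g gI]] := nR (fun a => exists n, a *: w n = 0).
  split=> [|a b [n an] [m bm]|b a [n an]].
  - by exists 0%N; rewrite scale0r.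
  - exists (maxn n m); rewrite scalerDl (wS n) ?leq_maxl // (wS m) ?leq_maxr //.
    by rewrite addr0.
  - by exists n; rewrite -scalerA an scaler0.
have /choice[d dP] (l : 'I_n) : exists m, g l *: w m = 0.
  apply/gI; exists (fun k => (k == l)%:R).
  rewrite (bigD1 l) //= eqxx mul1r big1 ?addr0 // => k /negPf ->.
  by rewrite mul0r.
pose m := \max_l d l; have [_ _ [a am aN]] := fP _ (wN0 m); apply: aN.
have /gI[c ->] : exists k, a *: w k = 0 by exists m.+1.
rewrite scaler_suml big1 // => l _.
by rewrite -scalerA (wS (d l) m) ?scaler0 //; apply: leq_bigmax.
Qed.
End NoetherianModules.

Section NoetherianCohomology.
Variable A : cdgring.
Implicit Types M N : dgmod A.

Definition subcoh M i (U : M i -> Prop) : Prop :=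
  [/\ forall x, bdry x -> U x, forall x y, U x -> U y -> U (x - y) &
      forall t x, U x -> U (sc t x)].

(** Submodules of the cohomology are represented by their preimages among the cocycles, which is why
    [subcoh] demands all boundaries. *)
Definition coh_noetherian M : Prop :=
  forall i (U : M i -> Prop), subcoh U -> (forall x, U x -> cocyc x) ->
  exists E : seq (M i), (forall x, x \in E -> U x) /\
    forall W, subcoh W -> (forall x, x \in E -> W x) -> forall x, U x -> W x.

Lemma subcohD M i (U : M i -> Prop) : subcoh U -> forall x y, U x -> U y -> U (x + y).
Proof.
move=> [U0 UB _] x y Ux Uy; have -> : x + y = x - (0 - y) by rewrite sub0r opprK.
exact: (UB _ _ Ux (UB _ _ (U0 _ (bdry0 _ _)) Uy)).
Qed.

Lemma subcoh_cong M i (U : M i -> Prop) : subcoh U ->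
  forall x y, bdry (x - y) -> U y -> U x.
Proof.
move=> Us x y xy Uy; rewrite -(subrK y x); apply: subcohD => //.
by case: Us => + _ _; apply.
Qed.

(** As for a noetherian module in the middle of an exact sequence: lift generators of the image of
    [U] in [M''], and add images of generators of its preimage in [M']. *)
Lemma coh_noetherian_exact M' M M'' (f : dghom M' M) (g : dghom M M'') :
  (forall i x, cocyc x -> bdry (g i x) ->
     exists2 y, cocyc y & bdry (x - f i y)) ->
  coh_noetherian M' -> coh_noetherian M'' -> coh_noetherian M.
Proof.
move=> ex nM' nM'' i U Us UZ; have [U0 UB UZ'] := Us.
pose U2 (y : M'' i) := exists2 u, U u & bdry (g i u - y).
have [||E2 [E2U E2W]] := nM'' i U2.
- split=> [y yB|y z [u Uu uy] [w Uw wz]|t y [u Uu uy]].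
  + by exists 0; [apply/U0/bdry0|rewrite raddf0 sub0r; apply: bdryN].
  + exists (u - w); first exact: UB.
    by rewrite cmB opprD addrACA -opprD; apply: bdryB.
  + by exists (sc t u); [apply: UZ'|rewrite dh_sc -scB; apply: sc_bdry].
- move=> y [u /UZ uZ uy]; rewrite -(subKr (g i u) y).
  by apply: cocycB; [apply: chmap_cocyc|apply: bdry_cocyc].
have /choice[e eP] y : exists u, U2 y -> U u /\ bdry (g i u - y).
  have [[u Uu uy]|nU] := EM (U2 y); first by exists u.
  by exists 0.
pose U1 (x : M' i) := cocyc x /\ U (f i x).
have [||E1 [E1U E1W]] := nM' i U1.
- split=> [x xB|x y [xZ Ux] [yZ Uy]|t x [xZ Ux]].
  + by split; [apply: bdry_cocyc|apply/U0/chmap_bdry].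
  + by split; [apply: cocycB|rewrite raddfB; apply: UB].
  + by split; [apply: sc_cocyc|rewrite dh_sc; apply: UZ'].
- by move=> x [].
exists ([seq f i x | x <- E1] ++ [seq e y | y <- E2]); split=> [x|W Ws EW x Ux].
  rewrite mem_cat => /orP[/mapP[y /E1U[_ Uy] ->]//|/mapP[y /E2U /eP[Ue _] -> //]].
have [W0 WB WZ] := Ws.
pose W2 (y : M'' i) := exists2 w, U w /\ W w & bdry (g i w - y).
have [|||w [Uw Ww] wx] := E2W W2 _ _ (g i x).
- split=> [y yB|y z [u [Uu Wu] uy] [w [Uw Ww] wz]|t y [u [Uu Wu] uy]].
  + exists 0; last by rewrite raddf0 sub0r; apply: bdryN.
    by split; [apply/U0/bdry0|apply/W0/bdry0].
  + exists (u - w); first by split; [apply: UB|apply: WB].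
    by rewrite cmB opprD addrACA -opprD; apply: bdryB.
  + exists (sc t u); last by rewrite dh_sc -scB; apply: sc_bdry.
    by split; [apply: UZ'|apply: WZ].
- move=> y yE; have [Ue ey] := eP y (E2U y yE); exists (e y) => //; split=> //.
  by apply: EW; rewrite mem_cat map_f ?orbT.
- by exists x; rewrite // subrr; apply: bdry0.
rewrite -raddfB in wx.
have [y yZ wxy] := ex i _ (UZ _ (UB _ _ Uw Ux)) wx.
have U1y : U1 y.
  split=> //; apply: subcoh_cong (UB _ _ Uw Ux) => //.
  by rewrite -[f i y - _]opprB; apply: bdryN.
rewrite -(subKr w x); apply: (WB _ _ Ww); apply: (subcoh_cong Ws wxy).
apply: (E1W (fun x => W (f i x))) U1y => [|z zE]; last first.
  by apply: EW; rewrite mem_cat map_f.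
split=> [z zB|z z' Wz Wz'|t z Wz]; first exact/W0/chmap_bdry.
  by rewrite cmB; apply: WB.
by rewrite dh_sc; apply: WZ.
Qed.

Lemma coh_noetherian_shift n M : coh_noetherian M -> coh_noetherian (shift n M).
Proof.
have sub i (U : shift n M i -> Prop) :
    subcoh U -> subcoh (fun x : M (i + n) => U x).
  case=> U0 UB UZ; split=> [x xB||t x Ux] //; first by apply/U0/bdry_shift.
  by rewrite -(sc_shift (n := n)); apply: UZ.
move=> nM i U /sub Us UZ; have [|E [EU EW]] := nM (i + n) _ Us.
  by move=> x Ux; apply/(@cocyc_shift _ n M)/UZ.
by exists E; split=> // W /sub Ws EsW x; apply: EW.
Qed.

Lemma coh_noetherian_pow b M : coh_noetherian M -> coh_noetherian (pow b M).
Proof.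
move=> nM; elim: b => [|b IHb].
  move=> i U _ _; exists [::]; split=> // W [W0 _ _] _ x _.
  have -> : x = 0 by apply/ffunP => -[].
  exact/W0/bdry0.
apply: (coh_noetherian_exact (f := dghom_comp (pow_join b M) (dsum_inr M (pow b M)))
  (g := pow_proj M ord0)) => // i x xZ xB.
pose y : pow b M i := [ffun l => (x : {ffun 'I_b.+1 -> M i}) (lift ord0 l)].
have yZ : cocyc y.
  apply/ffunP => l; have := congr1 (fun u : {ffun 'I_b.+1 -> M (i + 1)} =>
    u (lift ord0 l)) xZ.
  by rewrite !ffunE.
exists y => //; have [g' gK g'K] := pow_join_bij b M i.
have <- : dghom_comp (pow_join b M) (dsum_inl M (pow b M)) i (pow_proj M ord0 i x) =
    x - dghom_comp (pow_join b M) (dsum_inr M (pow b M)) i y.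
  apply/ffunP => l; rewrite !ffunE.
  by case: unliftP => [k ->|->] /=; rewrite ?ffunE /= ?subrr ?subr0.
exact: chmap_bdry.
Qed.

Lemma coh_noetherian_cone M N (f : dghom M N) :
  coh_noetherian M -> coh_noetherian N -> coh_noetherian (cone f).
Proof.
move=> /(coh_noetherian_shift (n := 1)) nM nN.
apply: (coh_noetherian_exact (f := cone_in f) (g := cone_out f)) nN nM.
by move=> i x; apply: cone_exact.
Qed.

Lemma coh_noetherian_surj M N (f : dghom M N) :
  (forall i x, cocyc x -> exists2 y, cocyc y & bdry (x - f i y)) ->
  coh_noetherian M -> coh_noetherian N.
Proof.
move=> sur nM; have n0 : coh_noetherian (pow 0 N).
  move=> i U _ _; exists [::]; split=> // W [W0 _ _] _ x _.
  have -> : x = 0 by apply/ffunP => -[].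
  exact/W0/bdry0.
have z : dghom N (pow 0 N).
  unshelve eexists; first exists (fun i _ => 0).
  - by move=> i x y; rewrite subrr.
  - by move=> i j ij x; rewrite raddf0.
  by move=> i j k e a m; apply/esym/(@act0 _ (pow 0 N)).
by apply: (coh_noetherian_exact (f := f) (g := z)) => // i x xZ _; apply: sur.
Qed.

Lemma coh_noetherian_regular : cohomologically_pseudo_noetherian A ->
  coh_noetherian (regular_mod A).
Proof.
move=> [nA fgA] i U Us UZ; have [U0 UB UZ'] := Us.
have scaleE (t : A 0) (x : cocycle A i) : exists2 y : cocycle A i,
    deg0_class t *: (cclass x : coh A i) = cclass y &
    val y = sc t (val x : regular_mod A i).
  exists (cocycle_mul (add0r i) (Sub t (deg0_cocycle_subproof t)) x).
    exact: coh_mul_class.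
  by rewrite -(scE (add0r i)).
pose cl (W : A i -> Prop) (u : coh A i) :=
  exists2 x : cocycle A i, u = cclass x & W (val x).
have cl_sub (W : A i -> Prop) : subcoh (W : regular_mod A i -> Prop) ->
    submodule (cl W).
  move=> [W0 WB WZ]; split=> [|u v [x -> Wx] [y -> Wy]|a u [x -> Wx]].
  - by exists 0; [rewrite raddf0|apply: (W0 0); apply: (@bdry0 A)].
  - by exists (x - y); [rewrite raddfB|apply: WB].
  - have [t ->] := cohE a; have [y ay yE] := scaleE (val t) x.
    exists y; last by rewrite yE; apply: WZ.
    by rewrite -ay; congr (_ *: _); congr cclass; apply: val_inj.
have cl_val (W : A i -> Prop) (x : cocycle A i) :
    subcoh (W : regular_mod A i -> Prop) -> cl W (cclass x) -> W (val x).
  move=> Ws [y /cclass_eq[z xy] Wy]; apply: (subcoh_cong Ws) Wy.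
  by rewrite xy; apply: (@bdryI A).
have [s sP] := fg_spanned (fgA i).
have [E [EU EW]] := noetherian_submodule nA (cl_sub U Us) (fun x _ => sP x).
exists [seq val (crepr u) | u <- E]; split=> [x /mapP[u uE ->]|W Ws EsW x Ux].
  by apply: cl_val => //; rewrite creprK; apply: EU.
have xZ : x \in cocycles A i by rewrite inE; apply/eqP; apply: UZ.
apply: (cl_val W (Sub x xZ)) => //; apply: EW; first exact: cl_sub.
  move=> u uE; exists (crepr u); rewrite ?creprK //.
  by apply: EsW; apply: map_f.
by exists (Sub x xZ).
Qed.

Definition canon_hom : dghom (regular_mod A) (Hbar_mod A).
Proof.
exists (canon A : chmap (regular_mod A) (Hbar_mod A)).
exact: (rhM (canon A)).
Defined.

Lemma canon_surj i (u : Hbar_mod A i) :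
  exists2 x : A i, cocyc x & canon A i x = u.
Proof.
have [i0|i0] := eqVneq i 0; last first.
  exists 0; first exact: cocyc0.
  by rewrite (@conc0 (Hbar A) i u i0) raddf0.
move: u; rewrite i0 => u; have [x ux] := cohE (val u).
exists (val x); first by apply: (@cocyc_deg0 A).
apply: val_inj; rewrite /= ux; congr cclass; exact: val_inj.
Qed.

Lemma coh_noetherian_Hbar : cohomologically_pseudo_noetherian A ->
  coh_noetherian (Hbar_mod A).
Proof.
move/coh_noetherian_regular; apply: (coh_noetherian_surj (f := canon_hom)) => i u _.
have [x xZ <-] := canon_surj u; exists x => //=; rewrite subrr.
exact: bdry0.
Qed.
End NoetherianCohomology.

(** * Attaching cells along generators *)

Section Attaching.
Variable A : cdgring.
Implicit Types M N : dgmod A.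
Local Notation R := (regular_mod A).

Lemma pow_cocyc b M i (x : pow b M i) :
  (forall l, cocyc (pow_proj M l i x)) -> cocyc x.
Proof. by move=> xZ; apply/ffunP => l; rewrite !ffunE; apply: xZ. Qed.

Lemma pow_bdry b M i (x : pow b M i) :
  (forall l, bdry (pow_proj M l i x)) -> bdry x.
Proof.
move=> /choice[y yE]; exists [ffun l => y l].
by apply/ffunP => l; rewrite !ffunE; apply: yE.
Qed.

Definition deg0_one j (ej : 0 = j) : A j := ecast k (A k) ej (dgr1 A).

Lemma act_deg0_one M j c k (ej : 0 = j) (ck : c = k) (h : j + c = k) (x : M c) :
  act h (deg0_one ej) x = ecast i (M i) ck x.
Proof.
rewrite /deg0_one; case: _ / ej h => h; case: _ / ck h => h.
exact: act1.
Qed.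

Lemma cone_in_null M N (f : dghom M N) i (x : M i) :
  cocyc x -> bdry (cone_in f i (f i x)).
Proof.
elim/succ_ind: i x => h x xZ; have := cone_bdryI f x 0; congr bdry.
by apply/pair_equal_spec; rewrite xZ oppr0 raddf0 addr0.
Qed.

Definition to_deg0 j (ej : 0 = j) (x : A j) : A 0 := ecast k (A k) (esym ej) x.

Lemma act_to_deg0 M j c (ej : 0 = j) (h : j + c = c) (x : A j) (m : M c) :
  act h x m = sc (to_deg0 ej x) m.
Proof. by rewrite /to_deg0; case: _ / ej h x => h x /=; rewrite scE. Qed.

Lemma mul_to_deg0 i0 j k (ej : 0 = j) (h : i0 + j = k) (z : A i0) (x : A j) :
  bdry (sc (to_deg0 ej x) (z : R i0)) -> bdry (dgrM h z x).
Proof.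
rewrite /to_deg0; case: _ / ej h x => h x /=.
have iq : i0 = k by rewrite -h addr0.
case: _ / iq h => h; rewrite (dgrMC (add0r i0)) mul0r expr0z mulr1z.
by rewrite -(scE (add0r i0)).
Qed.

Section Attach.
Variables (M : dgmod A) (b : nat) (c : int) (e : 'I_b -> M c).
Hypothesis eZ : forall l, cocyc (e l).

Definition free := pow b (shift (- c) R).

Definition coord (l : 'I_b) i (x : free i) : R (i - c) := pow_proj (shift (- c) R) l i x.

(** The sign compensates those that [shift (- c)] puts on the differential and on the action. *)
Definition attach : dghom free M.
Proof.
unshelve eexists.
  exists (fun i (x : free i) =>
    \sum_l act (subrK c i) (coord l x : A (i - c)) (e l) *~ (-1) ^ (c * (i - c))).
    move=> i x y; rewrite -sumrB; apply: eq_bigr => l _.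
    by rewrite /coord cmB actBl mulrzBl.
  move=> i j ij x; rewrite raddf_sum; apply: eq_bigr => l _ /=.
  have e2 : i - c + (c + 1) = j by rewrite addrA subrK.
  rewrite cdMz (act_d (subrK c i) (shift_d_eq (- c) ij) erefl ij (subrK c j) e2).
  rewrite eZ act0 mul0rz addr0 /coord /= ffunE actMzl -mulrzA -sgnM.
  by congr (_ *~ (_ ^ _)); rewrite -ij; ring.
move=> i j k h s x; rewrite act_sum; apply: eq_bigr => l _.
rewrite actMz /coord /= ffunE /= actMzl.
rewrite (actA _ _ (subrK c j) h) -mulrzA -sgnM.
by congr (_ *~ (_ ^ _)); rewrite -h; ring.
Defined.

Definition basis (l0 : 'I_b) : free c :=
  [ffun l => if l == l0 then deg0_one (esym (subrr c)) else 0].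

Lemma basis_cocyc l0 : cocyc (basis l0).
Proof.
apply: pow_cocyc => l; rewrite /= ffunE; case: eqP => _; last exact: cocyc0.
apply/(@cocyc_shift _ _ R); move: (esym (subrr c)) => ej; rewrite /deg0_one.
by case: _ / ej; apply: (@cocyc_deg0 A).
Qed.

Lemma attach_basis l0 : attach c (basis l0) = e l0.
Proof.
rewrite /attach /= (bigD1 l0) //= big1 ?addr0 => [|l ll0]; last first.
  by rewrite /coord /= ffunE (negPf ll0) act0l mul0rz.
rewrite /coord /= ffunE eqxx (act_deg0_one _ erefl).
have -> : c * (c - c) = 0 by ring.
by rewrite expr0z mulr1z.
Qed.

(** Projection to the coordinate [l0] returns z up to sign. *)
Lemma tors_act_basis (S : A 0 -> Prop) i0 k (h : i0 + c = k) (z : A i0) l0 :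
  tors S (act h z (basis l0)) -> tors S (z : R i0).
Proof.
move/(tors_hom (pow_proj (shift (- c) R) l0))/(@tors_shift _ _ (- c) R).
rewrite /= !ffunE eqxx => -[t St]; rewrite scMz => /bdry_sgn tz; exists t => //.
move: tz; move: (shift_act_eq _ _) => {}h; move: (esym (subrr c)) h => ej.
rewrite /deg0_one; case: _ / ej; move: (k + - c) => q {}h.
have iq : i0 = q by rewrite -h addr0.
by case: _ / iq h => h; rewrite dgrM1r.
Qed.
End Attach.

Section LocalGenerators.
Variable S : A 0 -> Prop.
Hypothesis S1 : S (dgr1 A).
Hypothesis SM : forall s t, S s -> S t -> S (mul0 s t).

Definition generators M c b (e : 'I_b -> M c) : Prop :=
  (forall l, cocyc (e l)) /\
  forall x, cocyc x ->
    exists t a, S t /\ tors S (sc t x - \sum_l sc (a l) (e l)).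

Lemma sc_sum M i t (I : finType) (F : I -> M i) :
  sc t (\sum_l F l) = \sum_l sc t (F l).
Proof. by rewrite -(scE (add0r i)) act_sum; apply: eq_bigr => l _; rewrite scE. Qed.

Lemma generators_exist M c : coh_noetherian M ->
  exists b (e : 'I_b -> M c), generators e.
Proof.
move=> nM; have [||E [EZ EW]] := nM c (@cocyc M c).
- split; [exact: bdry_cocyc|exact: cocycB|exact: sc_cocyc].
- by [].
exists (size E), (fun l => nth 0 E l); split=> [l|x xZ]; first by apply/EZ/mem_nth.
pose W x := exists a : 'I_(size E) -> A 0,
  bdry (x - \sum_l sc (a l) (nth 0 E l : M c)).
suff [a xa] : W x by exists (dgr1 A), a; rewrite sc1; split=> //; apply: bdry_tors.
apply: EW xZ => [|y /(nthP 0)[k kE <-]].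
  split=> [y yB|y u [a ya] [a' ua']|t y [a ya]].
  - by exists (fun=> 0); rewrite big1 ?subr0 // => l _; rewrite sc0l.
  - exists (fun l => a l - a' l).
    have -> : y - u - \sum_l sc (a l - a' l) (nth 0 E l : M c) =
        (y - \sum_l sc (a l) (nth 0 E l : M c)) -
        (u - \sum_l sc (a' l) (nth 0 E l : M c)).
      rewrite [- (u - _)]opprD [RHS]addrACA -[- _ - - _]opprD -sumrB; congr (_ - _).
      by apply: eq_bigr => l _; rewrite scBl.
    exact: bdryB.
  - exists (fun l => mul0 t (a l)); have := sc_bdry t ya; rewrite scB sc_sum.
    by congr (bdry (_ - _)); apply: eq_bigr => l _; rewrite scM.
exists (fun l => if l == Ordinal kE then dgr1 A else 0).
rewrite (bigD1 (Ordinal kE)) //= eqxx sc1 big1 ?addr0 ?subrr; first exact: bdry0.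
by move=> l /negPf ->; rewrite sc0l.
Qed.

(** Choose the least number of local generators. A relation with a coefficient in [S] could be
    solved locally for the corresponding generator, making it redundant; this takes the place of
    Nakayama's lemma. *)
Lemma minimal_generators M c : coh_noetherian M ->
  exists b (e : 'I_b -> M c), generators e /\
    forall a : 'I_b -> A 0, tors S (\sum_l sc (a l) (e l)) -> forall l, ~ S (a l).
Proof.
move=> nM; pose P b := `[< exists e : 'I_b -> M c, generators e >].
have exP : exists b, P b.
  by have [b [e eg]] := generators_exist c nM; exists b; apply/asboolP; exists e.
case: (ex_minnP exP) => b /asboolP[e [eZ eg]] bmin; exists b, e; split=> // a aB l0 Sa.
case: b l0 e eZ eg bmin a aB Sa => [[]//|b] l0 e eZ eg bmin a aB Sa.
suff /bmin : P b by rewrite ltnn.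
apply/asboolP; exists (fun l => e (lift l0 l)); split=> // x xZ.
have [t [d [St xd]]] := eg x xZ.
(* Multiply the expression of t x by [a l0] and eliminate [e l0] by means of the relation. *)
exists (mul0 (a l0) t),
  (fun l => mul0 (a l0) (d (lift l0 l)) - mul0 (d l0) (a (lift l0 l))).
split; first exact: SM.
have -> : sc (mul0 (a l0) t) x - \sum_(l < b) sc (mul0 (a l0) (d (lift l0 l))
      - mul0 (d l0) (a (lift l0 l))) (e (lift l0 l)) =
    sc (a l0) (sc t x - \sum_l sc (d l) (e l)) +
    sc (d l0) (\sum_l sc (a l) (e l)).
  rewrite !(bigD1_ord l0 (P := xpredT) isT) /= scM scB !scD.
  rewrite [sc (d l0) (sc (a l0) _)]scC !sc_sum.
  rewrite [sc _ _ + \sum__ _]addrC opprD addrA addrA subrK -addrA; congr (_ + _).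
  apply: oppr_inj; rewrite opprK opprD opprK -sumrB; apply: eq_bigr => l _.
  by rewrite scBl !scM.
by apply: torsD => //; apply: tors_sc.
Qed.
End LocalGenerators.
End Attaching.

(** * The lowest cohomology class *)

Section LowestClass.
Variables (A : cdgring) (i0 : int) (z : A i0).
Implicit Types M N : dgmod A.
Local Notation R := (regular_mod A).
Hypothesis zZ : cocyc z.
Hypothesis low : forall k (x : A k), k < i0 -> cocyc x -> bdry x.

(** The complement of the annihilator p of the class of z; [S1] and [SM] say that p is a prime
    ideal. *)
Definition outside (t : A 0) : Prop := ~ bdry (sc t (z : R i0)).
Hypothesis S1 : outside (dgr1 A).
Hypothesis SM : forall s t, outside s -> outside t -> outside (mul0 s t).

Lemma not_tors_z : ~ tors outside (z : R i0).
Proof. by case=> t. Qed.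

Lemma local_acyclic_cone_inj M N (f : dghom M N) i (x : M i) :
  local_acyclic outside (cone f) -> cocyc x -> bdry (f i x) -> tors outside x.
Proof.
elim/succ_ind: i x => h x aC xZ /(bdryE erefl)[y xy].
have /(tors_hom (cone_out f))/(@tors_shift _ _ 1 M) // :
  tors outside ((x, - y) : cone f h).
by apply: aC; apply/cone_cocyc; split=> //; rewrite xy raddfN subrr.
Qed.

Section AttachCone.
Variables (M : dgmod A) (b : nat) (h : int) (e : 'I_b -> M (h + 1)).
Hypothesis gen : generators outside e.
Let eZ l : cocyc (e l) := gen.1 l.
Let N := cone (attach eZ).

(** From degree [h + 1] on, the free part of the cone has its coordinates in positive degrees of
    [A], hence vanishes; in degree [h + 1] itself the cells kill the local generators. *)
Lemma local_trunc_attach :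
  local_trunc outside (h + 1 + 1) M -> local_trunc outside (h + 1) N.
Proof.
move=> tM q [a m] hq /cone_cocyc[aZ am].
have a0 : a = 0.
  apply/ffunP => l; rewrite ffunE; apply: dgr_nonpos.
  by rewrite subr_gt0 (le_lt_trans hq) // ltrDl.
have mZ : cocyc m by rewrite a0 raddf0 add0r in am.
rewrite a0; change (tors outside (cone_in (attach eZ) q m)).
have [hq'|qh] := ltP (h + 1) q.
  by apply/tors_hom/tM => //; rewrite lezD1.
have {qh}qE : h + 1 = q by apply/le_anti; rewrite hq.
case: _ / qE m mZ {a a0 hq aZ am} => m mZ.
have [t [d [St td]]] := gen.2 m mZ.
apply: (tors_scE SM St); rewrite -dh_sc.
apply: (tors_cong S1 SM (y := cone_in (attach eZ) _ (\sum_l sc (d l) (e l)))).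
  by rewrite -cmB; apply: tors_hom.
apply: bdry_tors => //.
have -> : \sum_l sc (d l) (e l) =
    attach eZ _ (\sum_l sc (d l) (basis A (h + 1) l)).
  rewrite cm_sum; apply: eq_bigr => l _.
  by rewrite dh_sc attach_basis.
apply: cone_in_null; apply: (big_ind (@cocyc _ _)) => [|x y|l _].
- exact: cocyc0.
- exact: cocycD.
- by apply/sc_cocyc/basis_cocyc.
Qed.

(** The free part of a cocycle of degree [h] has coordinates in degree 0 of [A], and they form a
    relation between the generators. By minimality they lie in p, so z kills them and z n comes from
    [M]. *)
Lemma act_z_cone (n : N h) :
  cocyc n -> (forall a : 'I_b -> A 0, tors outside (\sum_l sc (a l) (e l)) ->
     forall l, ~ outside (a l)) ->
  exists2 w : M (i0 + h), cocyc w & bdry (act erefl z n - cone_in (attach eZ) _ w).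
Proof.
move=> nZ minS; apply: cone_exact; first exact: act_cocyc.
rewrite dh_act; apply/(@bdry_shift _ 1 (free A b (h + 1))); apply: bdryMz.
case: n nZ => a m /cone_cocyc[aZ am].
have e0 : 0 = h + 1 - (h + 1) by rewrite subrr.
have nS l : ~ outside (to_deg0 e0 (coord l a)).
  apply: (minS (fun l => to_deg0 e0 (coord l a))); apply: bdry_tors => //.
  have : bdry (attach eZ _ a).
    by rewrite -[attach _ _ _](addrK (cd erefl m)) am sub0r; apply/bdryN/bdryI.
  congr bdry; apply: eq_bigr => l' _.
  have -> : (h + 1) * (h + 1 - (h + 1)) = 0 by ring.
  rewrite expr0z mulr1z; exact: act_to_deg0.
apply: pow_bdry => l; rewrite dh_act.
apply/(@bdry_shift _ _ R); apply: bdryMz.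
apply: mul_to_deg0; apply: contrapT => nB; exact: nS nB.
Qed.

(** The free part of x has coordinates of degree k - h < [i0], where [A] has no cohomology. *)
Lemma below_cone k (x : N k) : k < i0 + h -> cocyc x ->
  exists2 w : M k, cocyc w & bdry (x - cone_in (attach eZ) _ w).
Proof.
move=> kh xZ; apply: cone_exact => //; apply/(@bdry_shift _ 1 (free A b (h + 1))).
apply: pow_bdry => l; apply/(@bdry_shift _ _ R); apply: low.
  by rewrite opprD addrACA subrr addr0 ltrBlDr.
apply/(@cocyc_shift _ _ R); apply: chmap_cocyc.
exact/(@cocyc_shift _ 1 (free A b (h + 1)))/(chmap_cocyc (cone_out (attach eZ))).
Qed.

(** Here the attaching map is injective on local cohomology, so z kills [e l0] only if it kills a
    basis vector, that is, only if z is itself torsion. *)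
Lemma local_acyclic_attach l0 :
  local_acyclic outside N -> ~ bdry (act (erefl (i0 + (h + 1))) z (e l0)).
Proof.
move=> aN zB; have zb :
  ~ tors outside (act (erefl (i0 + (h + 1))) z (basis A (h + 1) l0)).
  by move/tors_act_basis/not_tors_z.
apply: zb; apply: local_acyclic_cone_inj aN _ _.
  by apply: act_cocyc => //; apply: basis_cocyc.
by rewrite dh_act attach_basis.
Qed.

(** The cone has no local cohomology from degree [h + 1] on, so [M -> N] is locally zero and [M] is
    locally a summand of the free module. Minimality makes the splitting carry each generator to its
    basis vector modulo p, and z kills p but not the basis vector. *)
Lemma ext_vanish_attach :
  local_trunc outside (h + 1 + 1) M -> ext_vanish outside (h + 1) M ->
  (forall a : 'I_b -> A 0, tors outside (\sum_l sc (a l) (e l)) ->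
     forall l, ~ outside (a l)) ->
  forall l0, ~ bdry (act (erefl (i0 + (h + 1))) z (e l0)).
Proof.
move=> tM vM minS l0 zB; pose f := cone_in (attach eZ).
have [Y [r rq]] := vM N (local_trunc_attach tM) f; have [inj sur] := rq.
pose p : dghom (cone f) (shift 1 (free A b (h + 1))) :=
  @cone_factor _ _ _ _ f (cone_out (attach eZ)) (fun=> fun=> erefl).
(* A cocycle lifting the basis vector through [p], the identification of the cone of [M -> N] with
   the shifted free module. *)
pose n0 : cone f h := (- e l0, (basis A (h + 1) l0 : shift 1 (free A b (h + 1)) h, 0)).
have n0Z : cocyc n0.
  apply/cone_cocyc; split; first exact/cocycN/eZ.
  apply/pair_equal_spec; split.
    rewrite /= add0r; apply: ((@cocyc_shift _ 1 (free A b (h + 1)) h _).2).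
    exact: basis_cocyc.
  by change (- e l0 + (attach eZ _ (basis A (h + 1) l0) + cd erefl (0 : M h)) = 0);
    rewrite raddf0 addr0 attach_basis addNr.
have z0Z : cocyc (act (erefl (i0 + h)) z n0) by apply: act_cocyc.
have [|n nZ n0n] := cone_exact z0Z.
  rewrite dh_act; apply/(@bdry_shift _ 1 M); apply: bdryMz.
  by have /bdryN := bdry_act_irr (shift_act_eq 1 erefl) zB; rewrite -actN.
(* On cohomology the composite with [f] vanishes already in the cone of [f], and the retraction [r]
   detects local classes of [N]. *)
have fT x : cocyc x -> tors outside (f (i0 + h) x).
  move=> xZ; apply: inj; first exact: chmap_cocyc.
  by apply: bdry_tors => //; apply: (chmap_bdry r); apply: cone_in_null.
have : tors outside n.
  apply: inj => //=; apply: (tors_cong S1 SM (y := r _ (act erefl z n0))).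
    by rewrite -cmB -opprB cmN; apply/bdry_tors/bdryN/chmap_bdry.
  (* The retraction replaces a multiple of [n0] by a cocycle [n1] of [N], to which [act_z_cone]
     applies: z [n1] comes from [M], hence is torsion by [fT]. *)
  have [t [n1 [St n1Z n1r]]] := sur _ _ (chmap_cocyc r n0Z).
  apply: (tors_scE SM St); rewrite dh_act sc_act.
  have [w wZ n1w] := act_z_cone n1Z minS.
  apply: (tors_cong S1 SM (y := r _ (cone_in f _ (act erefl z n1)))).
    rewrite !dh_act -actBr; apply: tors_act => //.
    by rewrite -opprB; apply: torsN.
  apply: tors_hom; apply: tors_hom; apply: (tors_cong S1 SM (y := f _ w)); last exact: fT.
  exact: bdry_tors.
move/(tors_hom (cone_out (attach eZ))) => nT.
have : tors outside (p _ (act erefl z n0)).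
  apply: (tors_cong S1 SM) nT.
  have : bdry (p _ (act erefl z n0 - cone_in f _ n)) by apply: chmap_bdry.
  by rewrite cmB => /(bdry_tors S1).
rewrite dh_act => /(@tors_shift _ _ 1 (free A b (h + 1))) [t St].
rewrite scMz => /bdry_sgn tz; apply: not_tors_z.
apply: (@tors_act_basis _ _ _ _ _ _ (shift_act_eq 1 erefl) z l0).
exists t; [exact: St|exact: tz].
Qed.

Lemma local_qiso_attach_nil : ('I_b -> False) -> local_qiso outside (cone_in (attach eZ)).
Proof.
move=> nob; apply: local_qiso_cone_in_acyclic => // i x _; apply: bdry_tors => //.
by apply: pow_bdry => l; case: (nob l).
Qed.

Lemma local_acyclic_attach_nil :
  ('I_b -> False) -> local_acyclic outside N -> local_acyclic outside M.
Proof.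
move=> /local_qiso_attach_nil[inj _] aN i x xZ; apply: inj => //.
by apply: aN; apply: chmap_cocyc.
Qed.

(** With no cells, [M -> N] is a local isomorphism that is also locally zero. *)
Lemma ext_vanish_attach_nil : ('I_b -> False) ->
  local_trunc outside (h + 1 + 1) M -> ext_vanish outside (h + 1) M ->
  local_acyclic outside M.
Proof.
move=> /local_qiso_attach_nil[inj _] tM vM i x xZ.
have [Y [r [rinj _]]] := vM N (local_trunc_attach tM) (cone_in (attach eZ)).
have fxZ := chmap_cocyc (cone_in (attach eZ)) xZ.
apply: inj => //; apply: rinj => //; apply: bdry_tors => //.
by apply: (chmap_bdry r); apply: cone_in_null.
Qed.

(** The shifted free module has bound [h], so the bound [m] survives while the top degree falls from
    [h + 1] to [h]: the gap shrinks by one. *)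
Lemma ext_vanish_attach_cone m : m <= h ->
  ext_vanish outside m M -> ext_vanish outside m N.
Proof.
move=> mh vM; apply: ext_vanish_cone => //.
have v0 := ext_vanish_pow (b := b) S1 SM
  (ext_vanish_shift (n := - (h + 1)) S1 SM (ext_vanish_regular S1 SM)).
by apply: (ext_vanish_le _ (ext_vanish_shift (n := 1) S1 SM v0)); lia.
Qed.
End AttachCone.

(** Either way [M] has a nonzero class in degree at most [i0 + c]. The first alternative records
    that it is a multiple of z, which [act_z_cone] needs in order to lift it. *)
Definition detected (c : int) M : Prop :=
  (exists2 e : M c, cocyc e & ~ bdry (act (erefl (i0 + c)) z e)) \/
  (exists k, k < i0 + c /\ exists2 w : M k, cocyc w & ~ bdry w).

Hypothesis nA : coh_noetherian R.

(** Induction on the gap [n] between the top degree [c] and the bound. A class detected in the cone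
    over a minimal free cover lifts to [M], by [act_z_cone] or [below_cone] according to the
    alternative; a locally acyclic cone means that [M] is locally free. *)
Lemma detected_ext_vanish (n : nat) c M :
  coh_noetherian M -> local_trunc outside (c + 1) M -> ext_vanish outside (c - n%:Z) M ->
  ~ local_acyclic outside M -> detected c M.
Proof.
elim: n c M => [|n IHn] c M; elim/succ_ind: c => h nM tM vM naM;
  have [b [e [gen minS]]] := minimal_generators S1 SM (h + 1) nM.
  have {}vM : ext_vanish outside (h + 1) M by move: vM; rewrite subr0.
  have [[l0 _]|nol] := EM (exists l : 'I_b, True).
    by left; exists (e l0); [apply: gen.1|apply: ext_vanish_attach].
  by case: naM; apply: (ext_vanish_attach_nil gen) => // l; case: nol; exists l.
have [aN|naN] := EM (local_acyclic outside (cone (attach gen.1))).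
  have [[l0 _]|nol] := EM (exists l : 'I_b, True).
    by left; exists (e l0); [apply: gen.1|exact: (local_acyclic_attach aN)].
  by case: naM; apply: (local_acyclic_attach_nil _ aN) => l; case: nol; exists l.
have nN : coh_noetherian (cone (attach gen.1)).
  by apply: coh_noetherian_cone => //; apply/coh_noetherian_pow/coh_noetherian_shift.
have vN : ext_vanish outside (h - n%:Z) (cone (attach gen.1)).
  apply: ext_vanish_attach_cone; first by rewrite gerBl.
  by have -> : h - n%:Z = h + 1 - n.+1%:Z by rewrite -addn1 PoszD; ring.
right.
case: (IHn h _ nN (local_trunc_attach tM) vN naN) => [[x xZ xB]|[k [kh [x xZ xB]]]].
  have [w wZ xw] := act_z_cone xZ minS.
  exists (i0 + h); split; first by rewrite addrA ltrDl.
  exists w => // wB; apply: xB; apply: (bdry_cong xw).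
  exact: chmap_bdry.
have [w wZ xw] := below_cone kh xZ.
exists k; split; first by rewrite addrA ltr_wpDr.
exists w => // wB; apply: xB; apply: (bdry_cong xw).
exact: chmap_bdry.
Qed.

(** If t kills 1 in Hbar then t is a boundary, hence so is t z, and t is not outside p. *)
Lemma Hbar_not_local_acyclic : ~ local_acyclic outside (Hbar_mod A).
Proof.
move=> aH; pose u : Hbar_mod A 0 := canon A 0 (dgr1 A).
have [|t St] := aH 0 u; first by apply: chmap_cocyc; apply: (@cocyc_deg0 A).
rewrite -[u]/(canon_hom A 0 (dgr1 A : R 0)) -dh_sc => -[y yE]; apply: St.
have /(congr1 val) : canon A 0 (sc t (dgr1 A : R 0)) = 0 by rewrite [LHS]yE.
rewrite /= -(raddf0 (@cclass A 0)) => /cclass_eq[a]; rewrite /= subr0 => ta.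
have tB : bdry (t : R 0).
  have -> : t = sc t (dgr1 A : R 0) by rewrite -(scE (add0r 0)) /= dgrM1r.
  by exists a.
by rewrite -(scE (add0r i0)); exact: (@act_bdryl _ R _ _ _ (add0r i0) t z tB zZ).
Qed.

Lemma perfect_lowest_class :
  i0 < 0 -> coh_noetherian (Hbar_mod A) -> ~ perfect (Hbar_mod A).
Proof.
move=> i00 nH /(perfect_ext_vanish S1 SM)[m vH].
have tH : local_trunc outside (0 + 1) (Hbar_mod A).
  move=> i x i1 _; have i0N : i != 0 by apply: lt0r_neq0; apply: lt_le_trans i1.
  by rewrite (@conc0 (Hbar A) i x i0N); apply/bdry_tors/bdry0.
(* The absolute value turns the integer bound into a weaker one of the form 0 - n with n natural, as
   the induction requires. *)
have {}vH : ext_vanish outside (0 - `|m|%N%:Z) (Hbar_mod A).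
  by apply: (ext_vanish_le _ vH); lia.
have [[e _ zB]|[k [ki [w _ wB]]]] := detected_ext_vanish nH tH vH Hbar_not_local_acyclic.
  have i0N : i0 + 0 != 0 by rewrite addr0 lt_eqF.
  by apply: zB; rewrite (@conc0 (Hbar A) _ (act _ z e) i0N); apply: bdry0.
have k0 : k != 0 by apply: ltr0_neq0; rewrite addr0 in ki; apply: lt_trans i00.
by apply: wB; rewrite (@conc0 (Hbar A) k w k0); apply: bdry0.
Qed.
End LowestClass.

(** * The choice of the lowest class and the conclusion *)

Lemma canon_quasi_iso (A : cdgring) :
  (forall k (x : A k), k < 0 -> cocyc x -> bdry x) -> quasi_iso (canon A).
Proof.
move=> low; apply: (local_qiso1_quasi_iso (f := canon_hom A)).
split=> [i x xZ [t -> xB]|i y _].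
  exists (dgr1 A) => //; move: xB; rewrite !sc1 => xB.
  have [i0|i0|i0] := ltgtP i 0; first exact: (low i x i0 xZ).
    by rewrite (dgr_nonpos (x : A i) i0); apply: (@bdry0 A).
  move: x xZ xB; rewrite i0 => x xZ [y yE].
  have /(congr1 val) : canon A 0 x = 0 by rewrite [LHS]yE.
  rewrite /= -(raddf0 (@cclass A 0)) => /cclass_eq[a]; rewrite /= subr0 => ta.
  by exists a.
have [x xZ <-] := canon_surj y; exists (dgr1 A), x; split=> //=.
by exists (dgr1 A) => //; rewrite !sc1 subrr; apply: bdry0.
Qed.

Lemma int_seq_min (s : seq int) : s != [::] ->
  exists2 m, m \in s & forall k, k \in s -> m <= k.
Proof.
elim: s => // a [|b s] IHs _.
  by exists a; [rewrite mem_head|move=> k; rewrite inE => /eqP ->].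
have [//|m ms mmin] := IHs; have [am|ma] := leP a m.
  exists a; first exact: mem_head.
  by move=> k; rewrite inE => /orP[/eqP ->//|/mmin]; apply: le_trans.
exists m; first by rewrite inE ms orbT.
by move=> k; rewrite inE => /orP[/eqP ->|/mmin //]; apply: ltW.
Qed.

Lemma lowest_cohomology (A : cdgring) : cohomologically_bounded A ->
  forall k (x : A k), cocyc x -> ~ bdry x ->
  exists i (z : A i), [/\ i <= k, cocyc z, ~ bdry z &
    forall j (y : A j), j < i -> cocyc y -> bdry y].
Proof.
move=> [s sP] k x xZ xB.
pose P i := `[< exists2 z : A i, cocyc z & ~ bdry z >].
have inS i : P i -> i \in s.
  move=> /asboolP[z zZ zB]; apply: contrapT => /negP/sP si; apply: zB.
  have zC : z \in cocycles A i by rewrite inE; apply/eqP.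
  have := si (cclass (Sub z zC)); rewrite -(raddf0 (@cclass A i)).
  by case/cclass_eq => a; rewrite /= subr0 => ->; exists a.
have kP : k \in [seq i <- s | P i].
  have Pk : P k by apply/asboolP; exists x.
  by rewrite mem_filter Pk inS.
have [|i] := @int_seq_min [seq i <- s | P i]; first by case: filter kP.
rewrite mem_filter => /andP[/asboolP[z zZ zB] _] imin.
exists i, z; split=> // [|j y ji yZ]; first exact: imin.
apply: contrapT => yB; suff /imin : j \in [seq i <- s | P i] by rewrite leNgt ji.
have Pj : P j by apply/asboolP; exists y.
by rewrite mem_filter Pj inS.
Qed.

(** Transfers [associated_prime] for the Hbar-module of cohomology in degree i to cocycles, in the
    form of the hypotheses [S1] and [SM] above. *)
Lemma associated_prime_class (A : cdgring) i (x : A i) :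
  noetherian (Hbar A) -> cocyc x -> ~ bdry x ->
  exists z : A i, [/\ cocyc z, outside z (dgr1 A) &
    forall s t, outside z s -> outside z t -> outside z (mul0 s t)].
Proof.
move=> nA xZ xB; have xC : x \in cocycles A i by rewrite inE; apply/eqP.
have clE (t : A 0) (y : cocycle A i) : deg0_class t *: (cclass y : coh A i) = 0 <->
    bdry (sc t (val y : regular_mod A i)).
  have -> : deg0_class t *: (cclass y : coh A i) = cclass (cocycle_mul (add0r i)
    (Sub t (deg0_cocycle_subproof t)) y) by exact: coh_mul_class.
  rewrite -(raddf0 (@cclass A i)) cclass_eq /= subr0 -(scE (add0r i)).
  by split=> -[a aE]; exists a; apply: aE.
have [|u [uN0 uP]] := @associated_prime (Hbar A) (coh A i) nA.
  exists (cclass (Sub x xC)); rewrite -(raddf0 (@cclass A i)) => /cclass_eq[a].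
  by rewrite /= subr0 => xE; apply: xB; exists a.
have [y uE] := cohE u; exists (val y); split.
- exact: cocycleP.
- rewrite /outside sc1 => -[a aE]; apply: uN0; rewrite uE -(raddf0 (@cclass A i)).
  by apply/cclass_eq; exists a; rewrite /= subr0.
move=> s t; rewrite /outside -!clE -uE => us ut; have := uP _ _ us ut.
congr (~ (_ *: _ = _)); rewrite [LHS]coh_mul_class; congr cclass; exact: val_inj.
Qed.

Theorem theorem0p7 (A : cdgring) (hb : cohomologically_bounded A)
    (ht : tractable A) (hp : perfect (Hbar_mod A)) :
  quasi_iso (canon A).
Proof.
have [nA _] := ht; apply: canon_quasi_iso => k x k0 xZ; apply: contrapT => xB.
have [i [y [ik yZ yB low]]] := lowest_cohomology hb xZ xB.
have [z [zZ S1 SM]] := associated_prime_class nA.1 yZ yB.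
apply: (perfect_lowest_class zZ low S1 SM) hp => //.
- exact: coh_noetherian_regular.
- exact: le_lt_trans k0.
- exact: coh_noetherian_Hbar.
Qed.
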